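(* Let $A=(A_n)_{n\in\mathbb N}$ be a sequence of pairs of commuting matrices (of possibly varying, not necessarily bounded sizes) with joint spectra in $\mathbb D^2$ such that $$\prod_{n\in\mathbb N}\rho_G\big(A_n, A_{\mathbb N\setminus \{n\}}\big)>0.$$ Then $A$ is interpolating for $\mathrm H^\infty_2$.
   Context: $\mathbb D$ is the open unit disc in $\mathbb C$; $\mathrm H^\infty_2$ is the algebra of bounded holomorphic functions on $\mathbb D^2$ with the supremum norm $\|\cdot\|_\infty$. If $M=(M^1,M^2)$ is a pair of commuting $m\times m$ complex matrices, its joint spectrum is the set of $\lambda=(\lambda^1,\lambda^2)\in\mathbb C^2$ for which there is a nonzero $x\in\mathbb C^m$ with $M^ix=\lambda^ix$, $i=1,2$. If the joint spectrum is contained in $\mathbb D^2$ and $f$ is holomorphic on $\mathbb D^2$, $f(M)$ is defined by the holomorphic functional calculus (Cauchy integral formula), equivalently $f(M)=\sum_l a_l (M^1)^{l_1}(M^2)^{l_2}$ if $f(z)=\sum_l a_l z^l$. $A=(A_n)$ is interpolating for $\mathrm H^\infty_2$ if for every bounded sequence $(\phi_n)_{n\in\mathbb N}$ in $\mathrm H^\infty_2$ there is $\phi\in\mathrm H^\infty_2$ with $\phi(A_n)=\phi_n(A_n)$ for all $n$. For $n\in\mathbb N$ and $\tau\subset\mathbb N$ not containing $n$, with $A_\tau=(A_j)_{j\in\tau}$, $$\rho_G(A_n,A_\tau):=\frac1{\inf\{\|\phi\|_\infty : \phi\in\mathrm H^\infty_2,\ \phi(A_n)=Id,\ \phi(A_j)=0\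 \text{for all } j\in\tau\}},$$ where the value is $0$ if no such $\phi$ exists. *)

(* Defs.v *)
From HB Require Import structures.
From mathcomp Require Import all_boot all_order all_algebra.
From mathcomp Require Import all_classical all_reals all_analysis.
From mathcomp Require Import complex.
Set Implicit Arguments.
Unset Strict Implicit.
Unset Printing Implicit Defensive.
Import Order.TTheory GRing.Theory Num.Theory numFieldNormedType.Exports.
Local Open Scope classical_set_scope.
Local Open Scope ring_scope.

(* The regular module R[i]^o is the copy of the complex numbers on which
   MathComp-Analysis puts the topology and the norm; the norm itself takes
   values in R[i], whence the real parts below. *)
Notation Cplx R := ((R[i])^o).

Definition bidisc (R : realType) : set (Cplx R * Cplx R) :=
  [set z | `|z.1| < 1 /\ `|z.2| < 1].

(* Complex differentiability at every point of the bidisc, which is open: only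
   the restriction of f to the bidisc matters. *)
Definition holomorphic (R : realType) (f : Cplx R * Cplx R -> Cplx R) : Prop :=
  forall z, bidisc z -> differentiable f z.

Definition abs_values (R : realType) (f : Cplx R * Cplx R -> Cplx R) : set R :=
  [set complex.Re `|f z| | z in @bidisc R].

Definition supnorm (R : realType) (f : Cplx R * Cplx R -> Cplx R) : R :=
  sup (abs_values f).

Definition Hinf (R : realType) : set (Cplx R * Cplx R -> Cplx R) :=
  [set f | holomorphic f /\ has_ubound (abs_values f)].

(* f(z) = \sum_l a_l z^l on the bidisc, as an absolutely convergent double
   series; it is therefore legitimate to sum over squares. *)
Definition power_series_expansion (R : realType)
    (f : Cplx R * Cplx R -> Cplx R) (a : nat -> nat -> Cplx R) : Prop :=
  forall z, bidisc z ->
    has_ubound (range (fun N : nat =>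
      \sum_(k < N) \sum_(l < N)
        complex.Re `|a k l * (z.1 ^+ k * z.2 ^+ l)|)) /\
    (fun N : nat => \sum_(k < N) \sum_(l < N) a k l * (z.1 ^+ k * z.2 ^+ l))
      @ \oo --> f z.

(* A holomorphic function on the bidisc has exactly one expansion, so the
   default value is irrelevant for such functions. *)
Definition power_series_coef (R : realType) (f : Cplx R * Cplx R -> Cplx R) :
    nat -> nat -> Cplx R :=
  xget (fun _ _ => 0) [set a | power_series_expansion f a].

(* Matrices have positive size: at size 0 the constraint phi(A_n) = Id below
   would be void. *)
Definition mxpair (R : realType) (m : nat) : Type :=
  ('M[Cplx R]_m.+1 * 'M[Cplx R]_m.+1)%type.

Definition fun_calculus (R : realType) (m : nat)
    (f : Cplx R * Cplx R -> Cplx R)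
    (M : mxpair R m) : 'M[Cplx R]_m.+1 :=
  limn (fun N : nat => \sum_(k < N) \sum_(l < N)
    power_series_coef f k l *: (M.1 ^+ k * M.2 ^+ l)).

Definition joint_spectrum (R : realType) (m : nat)
    (M : mxpair R m) : set (Cplx R * Cplx R) :=
  [set lam | exists x : 'cV[Cplx R]_m.+1,
     [/\ x != 0, M.1 *m x = lam.1 *: x & M.2 *m x = lam.2 *: x]].

Definition rhoG_norms (R : realType) (m : nat -> nat)
    (A : forall n, mxpair R (m n))
    (n : nat) (tau : set nat) : set R :=
  [set supnorm phi | phi in
    [set phi | [/\ Hinf phi, fun_calculus phi (A n) = 1%:M
                 & forall j, tau j -> fun_calculus phi (A j) = 0]]].

(* When the set of norms is nonempty its infimum is at least 1: phi(A_n) = Id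
   forces phi = 1 at the joint eigenvalues of A_n. *)
Definition rhoG (R : realType) (m : nat -> nat)
    (A : forall n, mxpair R (m n))
    (n : nat) (tau : set nat) : R :=
  if rhoG_norms A n tau == set0 then 0 else (inf (rhoG_norms A n tau))^-1.

Definition interpolating (R : realType) (m : nat -> nat)
    (A : forall n, mxpair R (m n)) : Prop :=
  forall phi : nat -> Cplx R * Cplx R -> Cplx R,
    (forall n, Hinf (phi n)) ->
    (exists B : R, forall n, supnorm (phi n) <= B) ->
    exists psi : Cplx R * Cplx R -> Cplx R,
      Hinf psi /\
      forall n, fun_calculus psi (A n) = fun_calculus (phi n) (A n).

(* Main.v *)
(* A function without a power series expansion has functional calculus 0, by
   the choice of default coefficients; so one may work with expansions only,
   and Cauchy's theorem for holomorphic functions is not needed.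

   Choose c_n < rho_n with c_n in (0, 1) and prod c_n > 0, and f_n in the unit
   ball with f_n(A_n) = c_n Id and f_n(A_k) = 0 for k <> n.  With
   a_n = 1 - c_n, the function h_n = a_n / (1 + a_n - f_n) satisfies
   |h_n|^2 + |1 - h_n|^2 <= 1, so the functions
   F_n = f_n h_n^2 prod_{j < n} (1 - h_j)^2 satisfy sum |F_n| <= 1 by
   telescoping.  Moreover F_n(A_k) = 0 for k <> n, and F_n(A_n) = b_n Id where
   b_n = (c_n / 4) prod_{j < n} (2 - c_j)^(-2) is bounded below because
   1 / (2 - c_j) >= c_j.  Hence psi = sum b_n^(-1) phi_n F_n interpolates. *)
From HB Require Import structures.
Require Import Defs.
From mathcomp Require Import all_boot all_order all_algebra.
From mathcomp Require Import all_classical all_reals all_analysis.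
From mathcomp Require Import complex.
From mathcomp Require Import ring lra zify.
Import Order.TTheory GRing.Theory Num.Theory numFieldNormedType.Exports.
Local Open Scope classical_set_scope.
Local Open Scope ring_scope.
Set Implicit Arguments.
Unset Strict Implicit.
Unset Printing Implicit Defensive.

(** * Complex modulus *)

Section Modulus.
Variable R : realType.
Implicit Types (x y z : Cplx R) (u : nat -> Cplx R).

(** The infimum in [rhoG] need not be attained and may equal 1. Taking c_n strictly below rho_n
    yields an actual competitor f_n and keeps a_n positive; over all n this costs at most a factor 2
    in the product. The choice a_n = 1 - c_n makes h_n(A_n) = 1/2 Id whatever c_n is, while (1 -
    h_n)(A_k) = (2 - c_n)^(-1) Id for k <> n stays close to Id when c_n is close to 1.

    Apart from the prescribed phi_n(A_n), every value of the calculus on the peak functions is a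
    scalar multiple of Id. Hence the constants do not see the sizes of the matrices, and no operator
    norm enters.

    The analytic obstacle is to exchange the infinite sum defining psi with evaluation at points and
    at matrices. Both evaluations pair the coefficient array with weights bounded by K r^(k+l), r <
    1, so both are handled by one dominated convergence argument. The majorant comes from Cauchy
    estimates, proved algebraically on polynomials instead of by contour integrals. Since the sums
    of moduli are bounded, the coefficients of the series converge by themselves and no normal
    family argument is required. *)

Definition nrm z : R := complex.Re `|z|.

Lemma normE z : `|z| = (nrm z)%:C%C.
Proof. by case: z. Qed.

Lemma nrm_ge0 z : 0 <= nrm z.
Proof. by rewrite -lecR -normE normr_ge0. Qed.

Lemma nrm0 : nrm 0 = 0.
Proof. by rewrite /nrm normr0. Qed.

Lemma nrm1 : nrm 1 = 1.
Proof. by rewrite /nrm normr1. Qed.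

Lemma nrm0_eq0 z : nrm z = 0 -> z = 0.
Proof. by move=> z0; apply/eqP; rewrite -normr_eq0 normE z0. Qed.

Lemma nrmM x y : nrm (x * y) = nrm x * nrm y.
Proof. by apply: (@complexI R); rewrite rmorphM/= -!normE normrM. Qed.

Lemma nrmX x n : nrm (x ^+ n) = nrm x ^+ n.
Proof. by elim: n => [|n IH]; rewrite ?expr0 ?nrm1// !exprS nrmM IH. Qed.

Lemma nrmV x : nrm x^-1 = (nrm x)^-1.
Proof. exact: ComplexField.Normc.normcV. Qed.

Lemma nrmN x : nrm (- x) = nrm x.
Proof. by rewrite /nrm normrN. Qed.

Lemma nrmBC x y : nrm (x - y) = nrm (y - x).
Proof. by rewrite -nrmN opprB. Qed.

Lemma ler_nrmD x y : nrm (x + y) <= nrm x + nrm y.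
Proof. by rewrite -lecR rmorphD/= -!normE ler_normD. Qed.

Lemma ler_nrmB x y : nrm (x - y) <= nrm x + nrm y.
Proof. by rewrite (le_trans (ler_nrmD _ _))// nrmN. Qed.

Lemma ler_dist_nrm x y : `|nrm x - nrm y| <= nrm (x - y).
Proof.
rewrite ler_norml; apply/andP; split.
  have := ler_nrmD (y - x) x; rewrite subrK nrmBC; lra.
have := ler_nrmD (x - y) y; rewrite subrK; lra.
Qed.

Lemma ler_nrm_sum (I : Type) (r : seq I) (P : pred I) (F : I -> Cplx R) :
  nrm (\sum_(i <- r | P i) F i) <= \sum_(i <- r | P i) nrm (F i).
Proof.
elim/big_ind2 : _ => //; first by rewrite nrm0.
by move=> a b c d ab cd; rewrite (le_trans (ler_nrmD _ _))// lerD.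
Qed.

Lemma nrm_real (t : R) : nrm t%:C%C = `|t|.
Proof. by rewrite /nrm /= expr0n/= addr0 sqrtr_sqr. Qed.

Lemma ler_normRe z : `|complex.Re z| <= nrm z.
Proof. by rewrite -lecR -normE normc_ge_Re. Qed.

Lemma ler_normIm z : `|complex.Im z| <= nrm z.
Proof.
have := normc_ge_Re (z * 'i%C); rewrite ReiNIm normrN normrM.
have -> : `|'i%C| = 1 :> R[i] by rewrite normc_def /= expr0n/= add0r expr1n sqrtr1.
by rewrite mulr1 -lecR -normE.
Qed.

Lemma norm_lt1 z : (`|z| < 1) = (nrm z < 1).
Proof. by rewrite normE -ltcR. Qed.

Lemma cvg_nrmP u z : (u @ \oo --> z) <-> (nrm (u n - z) @[n --> \oo] --> (0 : R)).
Proof.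
split=> [uz|uz].
  apply/cvgrPdist_lt => e e0.
  move/cvgrPdist_lt : uz => /(_ e%:C%C); rewrite ltcR => /(_ e0).
  apply: filterS => n; rewrite normE ltcR nrmBC => une.
  by rewrite sub0r normrN ger0_norm ?nrm_ge0.
apply/cvgrPdist_lt => e e0.
(* In the order of [R[i]], [0 < e] forces the imaginary part to vanish, so a complex tolerance is a
   real one. *)
have eE : e = (complex.Re e)%:C%C.
  by move: e0; rewrite ltcE /= => /andP[/eqP i0 _]; case: e i0 => a b /= ->.
have e0' : 0 < complex.Re e by rewrite -ltcR -eE.
move/cvgrPdist_lt : uz => /(_ _ e0').
apply: filterS => n; rewrite sub0r normrN ger0_norm ?nrm_ge0// => h.
by rewrite normE eE ltcR nrmBC.
Qed.

Lemma cvg_le_nrm u z (v : nat -> R) :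
  (forall n, nrm (u n - z) <= v n) -> v @ \oo --> (0 : R) -> u @ \oo --> z.
Proof.
move=> uv v0; apply/cvg_nrmP; apply: (squeeze_cvgr _ (cvg_cst 0) v0).
by apply: nearW => n; rewrite nrm_ge0 uv.
Qed.

Lemma cvg_nrm u z : u @ \oo --> z -> nrm (u n) @[n --> \oo] --> nrm z.
Proof.
move=> /cvg_nrmP uz; apply/subr_cvg0.
apply/norm_cvg0P; apply: (squeeze_cvgr _ (cvg_cst 0) uz).
by apply: nearW => n; rewrite normr_ge0 ler_dist_nrm.
Qed.

Lemma nrm_lim_le u z (B : R) :
  (forall n, nrm (u n) <= B) -> u @ \oo --> z -> nrm z <= B.
Proof.
move=> uB /cvg_nrm uz; rewrite -(cvg_lim (@Rhausdorff R) uz).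
apply: limr_le; first by apply/cvg_ex; exists (nrm z).
exact: nearW.
Qed.

Lemma cvgC_unique u z z' : u @ \oo --> z -> u @ \oo --> z' -> z = z'.
Proof. exact: cvg_unique. Qed.

End Modulus.

(** * Dominated double sums *)

Section DoubleSums.
Variable R : realType.
Implicit Types (x : nat -> nat -> Cplx R) (y : nat -> nat -> R).

Definition psum (V : zmodType) (x : nat -> nat -> V) (N : nat) : V :=
  \sum_(k < N) \sum_(l < N) x k l.

Lemma psumS (V : zmodType) (x : nat -> nat -> V) N :
  psum x N.+1 = psum x N + (\sum_(k < N) x k N + \sum_(l < N.+1) x N l).
Proof.
rewrite /psum big_ord_recr /= addrA; congr (_ + _).
by rewrite -big_split /=; apply: eq_bigr => k _; rewrite big_ord_recr.
Qed.

(** Consecutive squares differ by an L-shaped border, which is estimated term by term. *)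
Lemma psum_dist x y M N : (forall k l, nrm (x k l) <= y k l) -> (M <= N)%N ->
  nrm (psum x N - psum x M) <= psum y N - psum y M.
Proof.
move=> xy /subnK <-; elim: (N - M)%N => [|d IH]; first by rewrite !subrr nrm0.
rewrite addSn !psumS addrAC [leRHS]addrAC (le_trans (ler_nrmD _ _))// lerD//.
rewrite (le_trans (ler_nrmD _ _))// lerD// (le_trans (ler_nrm_sum _ _ _))//;
  by apply: ler_sum => i _.
Qed.

Lemma psum_ler x y N : (forall k l, nrm (x k l) <= y k l) ->
  nrm (psum x N) <= psum y N.
Proof.
move=> xy; have := @psum_dist x y 0 N xy (leq0n _).
by rewrite /psum !big_ord0 !subr0.
Qed.

Lemma psum_nondecreasing y : (forall k l, 0 <= y k l) ->
  nondecreasing_seq (psum y).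
Proof.
move=> y0; apply/nondecreasing_seqP => N; rewrite psumS lerDl.
by rewrite addr_ge0// sumr_ge0.
Qed.

Definition dsummable y (Y : R) := (forall k l, 0 <= y k l) /\ psum y @ \oo --> Y.

Lemma dsummable_le y Y N : dsummable y Y -> psum y N <= Y.
Proof.
move=> [y0 yY]; rewrite -(cvg_lim (@Rhausdorff R) yY).
apply: nondecreasing_cvgn_le; first exact: psum_nondecreasing.
by apply/cvg_ex; exists Y.
Qed.

Lemma dsummable_tail y Y : dsummable y Y -> (Y - psum y M) @[M --> \oo] --> (0 : R).
Proof. by move=> [_ yY]; rewrite -(subrr Y); apply: cvgB => //; exact: cvg_cst. Qed.

Lemma cvgC_sum (I : Type) (r : seq I) (P : pred I) (u : I -> nat -> Cplx R)
    (l : I -> Cplx R) : (forall i, P i -> u i @ \oo --> l i) ->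
  \sum_(i <- r | P i) u i n @[n --> \oo] --> \sum_(i <- r | P i) l i.
Proof.
move=> ul; elim: r => [|i r IH].
  rewrite big_nil (_ : (fun n => _) = fun=> 0); first exact: cvg_cst.
  by apply/funext => n; rewrite big_nil.
rewrite big_cons (_ : (fun n => _) = fun n =>
    (if P i then u i n else 0) + \sum_(i <- r | P i) u i n).
  case: ifPn => [/ul uil|_]; first exact: cvgD uil IH.
  rewrite (_ : (fun n => _) = fun n => \sum_(i <- r | P i) u i n)//.
  by apply/funext => n; rewrite add0r.
by apply/funext => n; rewrite big_cons; case: ifP; rewrite ?add0r.
Qed.

(** Completeness is obtained from the real and imaginary parts separately. The explicit Cauchy
    modulus [t] passes to the limit, which later gives tail bounds uniform in parameters. *)
Lemma cvg_tail (u : nat -> Cplx R) (t : nat -> R) :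
  (forall M N, (M <= N)%N -> nrm (u N - u M) <= t M) -> t @ \oo --> (0 : R) ->
  exists2 l, u @ \oo --> l & forall M, nrm (l - u M) <= t M.
Proof.
move=> ut t0.
have cau (p : Cplx R -> R) : (forall a b, p (a - b) = p a - p b) ->
    (forall a, `|p a| <= nrm a) -> cvgn (p \o u).
  move=> pB pn; apply: cauchy_cvg; apply: cauchy_exP => e e0.
  move/cvgrPdist_lt : t0 => /(_ _ e0) [M _ hM].
  exists (p (u M)); exists M => // N /= MN.
  rewrite /ball /= distrC -pB (le_lt_trans (pn _))// (le_lt_trans (ut _ _ MN))//.
  have := hM M (leqnn _); rewrite /= sub0r normrN; apply: le_lt_trans.
  exact: ler_norm.
have cre : cvgn (@complex.Re R \o u).
  by apply: cau; [move=> [? ?] [? ?] | exact: ler_normRe].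
have cim : cvgn (@complex.Im R \o u).
  by apply: cau; [move=> [? ?] [? ?] | exact: ler_normIm].
set l := (limn (@complex.Re R \o u) +i* limn (@complex.Im R \o u))%C : Cplx R.
have ul : u @ \oo --> l.
  apply: (@cvg_le_nrm _ _ _ (fun n => `|complex.Re (u n) - complex.Re l| +
                                      `|complex.Im (u n) - complex.Im l|)).
    move=> n; case: (u n) l => [a b] [c d] /=.
    have -> : ((a +i* b)%C - (c +i* d)%C : Cplx R) =
       (a - c)%:C%C + 'i%C * (b - d)%:C%C.
      by apply/eqP; rewrite eq_complex /=; apply/andP; split; apply/eqP; ring.
    rewrite (le_trans (ler_nrmD _ _))// nrmM !nrm_real.
    have -> : nrm ('i%C : Cplx R) = 1.
      by rewrite /nrm /= expr0n/= add0r expr1n sqrtr1.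
    by rewrite mul1r.
  rewrite -[X in _ --> X](addr0 (0 : R)).
  by apply: cvgD; apply/norm_cvg0P/subr_cvg0.
exists l => // M; apply: (@nrm_lim_le _ (fun N => u (N + M)%N - u M)).
  by move=> N; apply: ut; rewrite leq_addl.
by apply: cvgB; [rewrite (cvg_shiftn M u) | exact: cvg_cst].
Qed.

Lemma psum_cvg x y Y : (forall k l, nrm (x k l) <= y k l) -> dsummable y Y ->
  exists2 S, psum x @ \oo --> S & forall M, nrm (S - psum x M) <= Y - psum y M.
Proof.
move=> xy yY; apply: cvg_tail; last exact: dsummable_tail yY.
by move=> M N MN; rewrite (le_trans (psum_dist xy MN))// lerB// dsummable_le.
Qed.

Lemma psum_cvg_tail x y Y S : (forall k l, nrm (x k l) <= y k l) ->
  dsummable y Y -> psum x @ \oo --> S ->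
  forall M, nrm (S - psum x M) <= Y - psum y M.
Proof.
by move=> xy yY xS; have [S' /(cvgC_unique xS) <-] := psum_cvg xy yY.
Qed.

(** Dominated convergence for double sums, by splitting [S n - S0] into two tails and one finite
    sum. The tail bound is asked only for [M <= n], which suits sums that themselves stop at a size
    growing with [n]. *)
Lemma tannery (S : nat -> Cplx R) (xn : nat -> nat -> nat -> Cplx R) S0 x
    (t : nat -> R) : t @ \oo --> (0 : R) ->
  (forall n M, (M <= n)%N -> nrm (S n - psum (xn n) M) <= t M) ->
  (forall M, nrm (S0 - psum x M) <= t M) ->
  (forall k l, xn n k l @[n --> \oo] --> x k l) ->
  S @ \oo --> S0.
Proof.
move=> t0 St S0t xnx; apply/cvg_nrmP/cvgrPdist_lt => e e0.
have e3 : 0 < e / 3 by rewrite divr_gt0.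
move/cvgrPdist_lt : (t0) => /(_ _ e3) [M _ /(_ M (leqnn _))] /=.
rewrite sub0r normrN => tM.
have {}tM : t M < e / 3 by exact: le_lt_trans (ler_norm _) tM.
have : psum (xn n) M @[n --> \oo] --> psum x M.
  by do 2!apply: cvgC_sum => ? _; exact: xnx.
move=> /cvg_nrmP/cvgrPdist_lt /(_ _ e3) [N _ hN].
exists (maxn M N) => // n /=; rewrite geq_max => /andP[Mn Nn].
have := hN n Nn; rewrite /= !sub0r !normrN !ger0_norm ?nrm_ge0// => h.
have -> : S n - S0 = (S n - psum (xn n) M) + (psum (xn n) M - psum x M)
   - (S0 - psum x M) by ring.
have := ler_nrmB ((S n - psum (xn n) M) + (psum (xn n) M - psum x M)) (S0 - psum x M).
have := ler_nrmD (S n - psum (xn n) M) (psum (xn n) M - psum x M).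
have := St _ _ Mn; have := S0t M; lra.
Qed.

Lemma dsummableZ y Y (D : R) : 0 <= D -> dsummable y Y ->
  dsummable (fun k l => D * y k l) (D * Y).
Proof.
move=> D0 [y0 yY]; split=> [k l|]; first by rewrite mulr_ge0.
have -> : psum (fun k l => D * y k l) = fun N => D * psum y N.
  apply/funext => N; rewrite /psum mulr_sumr; apply: eq_bigr => k _.
  by rewrite mulr_sumr.
by apply: cvgM => //; exact: cvg_cst.
Qed.

Lemma dsummable_geo (r : R) : 0 <= r -> r < 1 ->
  dsummable (fun k l => r ^+ (k + l)) ((1 - r)^-1 ^+ 2).
Proof.
move=> r0 r1; split=> [k l|]; first by rewrite exprn_ge0.
have -> : psum (fun k l => r ^+ (k + l)) = fun N => (series (geometric 1 r) N) ^+ 2.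
  apply/funext => N; rewrite /psum /series /= big_mkord expr2 mulr_suml.
  apply: eq_bigr => k _; rewrite mulr_sumr; apply: eq_bigr => l _.
  by rewrite /geometric /= !mul1r exprD.
apply: cvgM; rewrite -[(1 - r)^-1]mul1r; apply: cvg_geometric_series;
  by rewrite ger0_norm.
Qed.

(** Each of the [k + 1] powers [s^i] with [i <= k] is at least [s^k], and their sum is below the
    geometric series. This absorbs the number of terms in a Cauchy product. *)
Lemma exp_natr_le (s : R) k : 0 <= s -> s < 1 -> k.+1%:R * s ^+ k <= (1 - s)^-1.
Proof.
move=> s0 s1; rewrite -(mul1r (_^-1)) ler_pdivlMr ?subr_gt0//.
have h : (k.+1)%:R * s ^+ k <= \sum_(i < k.+1) s ^+ i.
  rewrite -[X in X%:R](card_ord k.+1) -sum1_card natr_sum mulr_suml.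
  by apply: ler_sum => i _; rewrite mul1r ler_wiXn2l// ?ltW// -ltnS.
apply: (le_trans (ler_wpM2r _ h)); first by rewrite subr_ge0 ltW.
have : (1 - s) * (\sum_(i < k.+1) s ^+ i) = 1 - s ^+ k.+1.
  by rewrite -(opprB s 1) mulNr -subrX1 opprB.
by rewrite mulrC => ->; rewrite gerBl exprn_ge0.
Qed.

End DoubleSums.

(** * Cauchy estimates for power series *)

Section CauchyEstimates.
Variable R : realType.
Implicit Types (a : nat -> nat -> Cplx R) (f : Cplx R * Cplx R -> Cplx R).
Implicit Types (z : Cplx R * Cplx R).

(* The even part [e] and the odd part [o] of [p] satisfy
   [2 e(t^2) = p(t) + p(- t)] and [2 t o(t^2) = p(t) - p(- t)], so they inherit
   the bound of [p] on the circle. *)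
Lemma coef_le_circle (p : {poly (R[i])}) (B : R) :
  (forall t : R[i], nrm (t : Cplx R) = 1 -> nrm (p.[t] : Cplx R) <= B) ->
  forall k, nrm (p`_k : Cplx R) <= B.
Proof.
move: {2}(size p) (leqnn (size p)) => n.
elim/ltn_ind: n p => n IH p pn pB k.
have [p1|p1] := leqP (size p) 1.
  have B0 : 0 <= B by rewrite (le_trans (nrm_ge0 _) (pB 1 (nrm1 R))).
  have := pB 1 (nrm1 R); rewrite (size1_polyC p1) hornerC coefC.
  by case: ifP => // _; rewrite nrm0.
have evE (t : R[i]) : (even_poly p).[t ^+ 2] + (odd_poly p).[t ^+ 2] * t = p.[t].
  by rewrite -{3}(poly_even_odd p) !hornerE !horner_comp !hornerE.
have oddE (t : R[i]) : (even_poly p).[t ^+ 2] - (odd_poly p).[t ^+ 2] * t = p.[- t].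
  by rewrite -evE sqrrN mulrN.
have sq (s : R[i]) : nrm (s : Cplx R) = 1 -> exists2 t : R[i], nrm (t : Cplx R) = 1 & t ^+ 2 = s.
  move=> s1; exists (sqrtc s); last exact: sqr_sqrtc.
  have : nrm (sqrtc s : Cplx R) ^+ 2 = 1 by rewrite -nrmX -s1; congr nrm; exact: sqr_sqrtc.
  by move=> /eqP; rewrite sqrp_eq1 ?nrm_ge0// => /eqP.
have half (x y u v : Cplx R) : nrm u <= B -> nrm v <= B -> x + y = u -> x - y = v ->
    nrm x <= B /\ nrm y <= B.
  move=> uB vB xy xy'.
  have n2 : nrm (2%:R : Cplx R) = 2.
    by rewrite (_ : 2%:R = (2 : R)%:C%C) ?nrm_real ?ger0_norm// rmorph_nat.
  have hx : nrm (2%:R * x) <= 2 * B.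
    rewrite (_ : 2%:R * x = u + v); last by rewrite -xy -xy'; ring.
    by rewrite (le_trans (ler_nrmD _ _))// mulr_natl mulr2n lerD.
  have hy : nrm (2%:R * y) <= 2 * B.
    rewrite (_ : 2%:R * y = u - v); last by rewrite -xy -xy'; ring.
    by rewrite (le_trans (ler_nrmB _ _))// mulr_natl mulr2n lerD.
  by move: hx hy; rewrite !nrmM n2 !ler_pM2l.
have key (s : R[i]) : nrm (s : Cplx R) = 1 ->
    nrm ((even_poly p).[s] : Cplx R) <= B /\ nrm ((odd_poly p).[s] : Cplx R) <= B.
  move=> /sq[t t1 <-].
  have [he ho] := half _ _ _ _ (pB t t1)
    (pB (- t) (etrans (nrmN (t : Cplx R)) t1)) (evE t) (oddE t).
  split=> //; move: ho; rewrite (nrmM ((odd_poly p).[t ^+ 2] : Cplx R)) t1 mulr1//.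
rewrite -(odd_double_half k); case: (odd k) => /=; rewrite ?add1n ?add0n.
  rewrite -coef_odd_poly; apply: (IH (size (odd_poly p))) => //.
    apply: leq_trans pn; apply: (leq_ltn_trans (size_odd_poly _)).
    by rewrite -divn2 ltn_Pdiv// (ltn_trans _ p1).
  by move=> t /key[].
rewrite -coef_even_poly; apply: (IH (size (even_poly p))) => //.
  apply: leq_trans pn; apply: (leq_ltn_trans (size_even_poly _)).
  by rewrite uphalfE ltn_half_double -addnn; rewrite -{1}addn1 ltn_add2l.
by move=> t /key[].
Qed.

Lemma coef_sum_le_circle (c : nat -> Cplx R) N (B : R) :
  (forall t : Cplx R, nrm t = 1 -> nrm (\sum_(k < N) c k * t ^+ k) <= B) ->
  forall k, (k < N)%N -> nrm (c k) <= B.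
Proof.
move=> cB k kN; pose p : {poly R[i]} := \poly_(k < N) c k.
have -> : c k = p`_k by rewrite coef_poly kN.
by apply: coef_le_circle => t t1; rewrite horner_poly; exact: cB.
Qed.

Definition monom z (k l : nat) : Cplx R := z.1 ^+ k * z.2 ^+ l.

(** The common property of evaluation weights: the monomials at a point of the bidisc satisfy it,
    and so do the entries of the products of powers of a commuting pair with joint spectrum in the
    bidisc. *)
Definition geo_bounded (w : nat -> nat -> Cplx R) := exists K r : R,
  [/\ 0 <= K, 0 <= r, r < 1 & forall k l, nrm (w k l) <= K * r ^+ (k + l)].

(** The growth condition dual to [geo_bounded]: the pairing of the two kinds of array converges
    absolutely. *)
Definition subexp a := forall r : R, 0 < r -> r < 1 ->
  exists2 D, 0 <= D & forall k l, nrm (a k l) * r ^+ (k + l) <= D.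

Lemma nrm_monom z k l : nrm (monom z k l) = nrm z.1 ^+ k * nrm z.2 ^+ l.
Proof. by rewrite nrmM !nrmX. Qed.

Lemma bidiscP z : bidisc z <-> nrm z.1 < 1 /\ nrm z.2 < 1.
Proof. by rewrite /bidisc /= !norm_lt1. Qed.

Lemma geo_bounded_monom z : bidisc z -> geo_bounded (monom z).
Proof.
move=> /bidiscP[z1 z2]; exists 1, (Num.max (nrm z.1) (nrm z.2)); split=> //.
- by rewrite le_max nrm_ge0.
- by rewrite gt_max z1.
move=> k l; rewrite mul1r nrm_monom exprD ler_pM ?exprn_ge0 ?nrm_ge0//;
  by rewrite lerXn2r ?nnegrE ?le_max ?nrm_ge0 ?lexx ?orbT.
Qed.

(** If the weights decay like [r^(k+l)], the bound on [a] at a radius [s] strictly between [r] and 1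
    leaves the summable factor [(r/s)^(k+l)]. *)
Lemma subexp_dom a w : subexp a -> geo_bounded w ->
  exists D q : R, [/\ 0 <= D, 0 <= q, q < 1 &
    forall k l, nrm (a k l * w k l) <= D * q ^+ (k + l)].
Proof.
move=> ha [K [r [K0 r0 r1 hw]]].
pose s := (1 + r) / 2.
have s0 : 0 < s by rewrite /s; lra.
have s1 : s < 1 by rewrite /s; lra.
have rs : r < s by rewrite /s; lra.
have [D D0 hD] := ha s s0 s1.
exists (D * K), (r / s); split.
- exact: mulr_ge0.
- by rewrite divr_ge0// ltW.
- by rewrite ltr_pdivrMr// mul1r.
move=> k l; rewrite nrmM expr_div_n mulrACA (mulrC D) -mulrA.
rewrite [leRHS](_ : _ = D / s ^+ (k + l) * (K * r ^+ (k + l))); last by ring.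
apply: ler_pM; rewrite ?nrm_ge0//.
by rewrite ler_pdivlMr ?exprn_gt0.
Qed.

Lemma subexp_dsummable a w : subexp a -> geo_bounded w ->
  exists y Y, dsummable y Y /\ forall k l, nrm (a k l * w k l) <= y k l.
Proof.
move=> ha hw; have [D [q [D0 q0 q1 h]]] := subexp_dom ha hw.
eexists; eexists; split; first exact: dsummableZ D0 (dsummable_geo q0 q1).
exact: h.
Qed.

Definition wsum a (w : nat -> nat -> Cplx R) : nat -> Cplx R :=
  psum (fun k l => a k l * w k l).

(** Working form of [power_series_expansion]: absolute convergence at points is replaced by growth
    of the coefficients, which can also be used against matrix weights. *)
Definition expands f a :=
  subexp a /\ forall z, bidisc z -> wsum a (monom z) @ \oo --> f z.

(** At the point [(r, r)] the bounded sums of moduli dominate each single term [|a_kl| r^(k+l)]. *)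
Lemma expansion_expands f a : power_series_expansion f a -> expands f a.
Proof.
move=> ha; split=> [r r0 r1|z /ha[]//].
have bd : bidisc ((r%:C%C, r%:C%C) : Cplx R * Cplx R).
  by apply/bidiscP; rewrite /= nrm_real gtr0_norm.
have [[B hB] _] := ha _ bd.
have y0 k l : 0 <= nrm (a k l) * r ^+ (k + l).
  by rewrite mulr_ge0 ?nrm_ge0// exprn_ge0// ltW.
have yB N : psum (fun k l => nrm (a k l) * r ^+ (k + l)) N <= B.
  apply: hB; exists N => //; apply: eq_bigr => k _; apply: eq_bigr => l _.
  rewrite -/(nrm _) (nrmM (a k l)) (nrmM (_ ^+ _ : Cplx R)).
  by rewrite !(nrmX (r%:C%C : Cplx R)) nrm_real gtr0_norm// exprD.
exists B; first by apply: le_trans (yB 0%N); rewrite /psum big_ord0.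
move=> k l; apply: (le_trans _ (yB (maxn k l).+1)).
have kN : (k < (maxn k l).+1)%N by rewrite ltnS leq_maxl.
have lN : (l < (maxn k l).+1)%N by rewrite ltnS leq_maxr.
rewrite /psum (bigD1 (Ordinal kN))//= (bigD1 (Ordinal lN))//= -addrA lerDl.
by rewrite addr_ge0// sumr_ge0// => i _; rewrite sumr_ge0.
Qed.

Lemma expands_expansion f a : expands f a -> power_series_expansion f a.
Proof.
move=> [ha fa] z bz; split; last exact: fa.
have [y [Y [yY h]]] := subexp_dsummable ha (geo_bounded_monom bz).
exists Y => _ [N _ <-]; apply: le_trans (dsummable_le N yY).
by apply: ler_sum => k _; apply: ler_sum => l _; exact: h.
Qed.

Lemma le_of_radius (x B : R) n :
  (forall r : R, 0 < r -> r < 1 -> x * r ^+ n <= B) -> x <= B.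
Proof.
move=> h.
(* [harmonic 0] is 1, so the factor 1/2 is what keeps [r 0] positive. *)
pose r m : R := 1 - 2^-1 * harmonic m.
have hr m : 0 < (harmonic m : R) <= 1.
  by rewrite /harmonic /= invr_gt0 ltr0Sn/= invf_le1 ?ltr0Sn// ler1n.
have r1 : r @ \oo --> (1 : R).
  rewrite -[X in _ --> X](subr0 (1 : R)) -[X in 1 - X](mulr0 (2^-1 : R)).
  by apply: cvgB; [exact: cvg_cst|apply: cvgM; [exact: cvg_cst|exact: cvg_harmonic]].
have rn : x * r m ^+ n @[m --> \oo] --> x.
  rewrite -[X in _ --> X](mulr1 x) -(expr1n R n); apply: cvgM; first exact: cvg_cst.
  by elim: n {h} => [|n IH]; [exact: cvg_cst|under eq_fun do rewrite exprS;
    rewrite exprS; exact: cvgM].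
rewrite -(cvg_lim (@Rhausdorff R) rn); apply: limr_le.
  by apply/cvg_ex; exists x.
by apply: nearW => m; apply: h; have /andP[] := hr m; rewrite /r; lra.
Qed.

(** On the torus of radius [r] a square partial sum is a polynomial in two unimodular variables,
    bounded by [B] plus a tail. The coefficient bound for polynomials is applied in each variable,
    then the size tends to infinity and finally [r] tends to 1. *)
Lemma cauchy_estimate f a (B : R) : expands f a ->
  (forall z, bidisc z -> nrm (f z) <= B) -> forall k l, nrm (a k l) <= B.
Proof.
move=> [ha fa] fB k l; apply: (@le_of_radius _ _ (k + l)) => r r0 r1.
have [|D [q [D0 q0 q1 hD]]] := @subexp_dom a (fun k l => r%:C%C ^+ (k + l)) ha.
  exists 1, r; split=> //; first exact: ltW.
  by move=> i j; rewrite (nrmX (r%:C%C : Cplx R)) nrm_real gtr0_norm// mul1r.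
have yY := dsummableZ D0 (dsummable_geo q0 q1).
set y := (fun k l => _) in yY; set Y := (X in dsummable _ X) in yY.
(* The tail is dominated by the same [y] at all points of the torus, so the error term is
   independent of [s] and [t]. *)
have est N : (k < N)%N -> (l < N)%N -> nrm (a k l) * r ^+ (k + l) <= B + (Y - psum y N).
  move=> kN lN.
  have -> : nrm (a k l) * r ^+ (k + l) = nrm (a k l * r%:C%C ^+ (k + l)).
    by rewrite (nrmM (a k l)) (nrmX (r%:C%C : Cplx R)) nrm_real gtr0_norm.
  apply: (@coef_sum_le_circle (fun l => a k l * r%:C%C ^+ (k + l)) N _ _ l lN).
  move=> t t1.
  apply: (@coef_sum_le_circle (fun k => \sum_(l < N) a k l * r%:C%C ^+ (k + l) * t ^+ l)
    N _ _ k kN) => s s1.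
  pose z : Cplx R * Cplx R := (r%:C%C * s, r%:C%C * t).
  have n1 : nrm z.1 = r by rewrite nrmM nrm_real s1 mulr1 gtr0_norm.
  have n2 : nrm z.2 = r by rewrite nrmM nrm_real t1 mulr1 gtr0_norm.
  have bz : bidisc z by apply/bidiscP; rewrite n1 n2.
  have -> : \sum_(k < N) (\sum_(l < N) a k l * r%:C%C ^+ (k + l) * t ^+ l) * s ^+ k =
      wsum a (monom z) N.
    apply: eq_bigr => i _; rewrite mulr_suml; apply: eq_bigr => j _.
    by rewrite /monom /= !exprMn exprD; ring.
  have dom i j : nrm (a i j * monom z i j) <= y i j.
    rewrite nrmM nrm_monom n1 n2 -exprD; have := hD i j.
    by rewrite (nrmM (a i j)) (nrmX (r%:C%C : Cplx R)) nrm_real gtr0_norm.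
  have := psum_cvg_tail dom yY (fa z bz) N; rewrite -/(wsum _ _ _) => tl.
  rewrite (_ : wsum a (monom z) N = f z - (f z - wsum a (monom z) N)); last by rewrite subKr.
  by rewrite (le_trans (ler_nrmB _ _))// lerD// fB.
have lim : B + (Y - psum y N) @[N --> \oo] --> B.
  by rewrite -[X in _ --> X](addr0 B); apply: cvgD; [exact: cvg_cst|exact: dsummable_tail yY].
rewrite -(cvg_lim (@Rhausdorff R) lim); apply: limr_ge.
  by apply/cvg_ex; exists B.
exists (maxn k l).+1 => // N /= hN; apply: est; apply: leq_trans hN;
  by rewrite ltnS ?leq_maxl ?leq_maxr.
Qed.

Lemma bounded_subexp a (B : R) : (forall k l, nrm (a k l) <= B) -> subexp a.
Proof.
move=> aB r r0 r1; exists B; first exact: le_trans (nrm_ge0 _) (aB 0%N 0%N).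
move=> k l; rewrite -[leRHS]mulr1; apply: ler_pM; rewrite ?nrm_ge0//.
  by rewrite exprn_ge0// ltW.
by rewrite exprn_ile1// ltW.
Qed.

Lemma subexpB a b : subexp a -> subexp b -> subexp (fun k l => a k l - b k l).
Proof.
move=> ha hb r r0 r1.
have [D D0 hD] := ha r r0 r1; have [E E0 hE] := hb r r0 r1.
exists (D + E); first exact: addr_ge0.
move=> k l; apply: le_trans (lerD (hD k l) (hE k l)).
by rewrite -mulrDl ler_wpM2r ?exprn_ge0 ?(ltW r0)// ler_nrmB.
Qed.

(** The difference of two expansions expands the zero function, and the Cauchy estimate with bound 0
    applies to it. *)
Lemma expands_unique f a b : expands f a -> expands f b -> a = b.
Proof.
move=> [ha fa] [hb fb].
have h : expands (fun=> 0) (fun k l => a k l - b k l).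
  split=> [|z bz]; first exact: subexpB.
  rewrite (_ : wsum _ _ = fun N => wsum a (monom z) N - wsum b (monom z) N).
    by rewrite -(subrr (f z)); apply: cvgB; [exact: fa|exact: fb].
  apply/funext => N; rewrite /wsum /psum -sumrB; apply: eq_bigr => k _.
  by rewrite -sumrB; apply: eq_bigr => l _; rewrite mulrBl.
apply/funext => k; apply/funext => l; apply/eqP; rewrite -subr_eq0; apply/eqP.
apply: nrm0_eq0; apply/eqP; rewrite eq_le nrm_ge0 andbT.
by apply: (cauchy_estimate h) => z _; rewrite nrm0.
Qed.

Lemma expands_coef f a : expands f a -> power_series_coef f = a.
Proof.
move=> fa; rewrite /power_series_coef.
case: xgetP => [b _ /expansion_expands fb|/(_ a)]; first exact: expands_unique fb fa.
by move/(_ (expands_expansion fa)).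
Qed.

Lemma no_expansion_coef f : ~ (exists a, expands f a) ->
  power_series_coef f = fun _ _ => 0.
Proof.
move=> nf; rewrite /power_series_coef.
by case: xgetP => [b _ /expansion_expands fb|//]; case: nf; exists b.
Qed.

End CauchyEstimates.

(** * Products of power series *)

Section Multiplicativity.
Variable R : realType.
Implicit Types (a b : nat -> nat -> Cplx R).

Lemma sum_triangle (V : zmodType) (u : nat -> nat -> V) N :
  \sum_(k < N) \sum_(i < k.+1) u i (k - i)%N = \sum_(i < N) \sum_(j < N - i) u i j.
Proof.
elim: N => [|N IH]; first by rewrite !big_ord0.
rewrite big_ord_recr /= IH big_ord_recr /= [in RHS]big_ord_recr /= subSnn big_ord1 subnn.
rewrite addrA -big_split /=; congr (_ + _); apply: eq_bigr => i _.
by rewrite subSn ?(ltnW (ltn_ord i))// big_ord_recr.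
Qed.

Lemma sum_trunc (V : zmodType) (u : nat -> V) n N : (n <= N)%N ->
  (forall i, (n <= i)%N -> u i = 0) -> \sum_(i < N) u i = \sum_(i < n) u i.
Proof.
move=> nN u0; rewrite (big_ord_widen _ u nN) [RHS]big_mkcond /=.
by apply: eq_bigr => i _; case: ltnP => // /u0.
Qed.

(** Indices [i, j < n] satisfy [i + j < n + n], so the antidiagonals below [n + n] exhaust the
    support of [u]. *)
Lemma sum_conv (V : zmodType) (u : nat -> nat -> V) n :
  (forall i j, ~~ ((i < n) && (j < n))%N -> u i j = 0) ->
  \sum_(k < n + n) \sum_(i < k.+1) u i (k - i)%N = \sum_(i < n) \sum_(j < n) u i j.
Proof.
move=> u0; rewrite sum_triangle (@sum_trunc _ (fun i => \sum_(j < n + n - i) u i j) n).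
- apply: eq_bigr => i _; apply: sum_trunc.
    by rewrite -addnBA ?leq_addr// ltnW.
  by move=> j nj; apply: u0; rewrite (leq_gtF nj) andbF.
- exact: leq_addr.
- by move=> i ni; rewrite big1// => j _; apply: u0; rewrite (leq_gtF ni).
Qed.

Definition conv (K : pzRingType) (a b : nat -> nat -> K) (k l : nat) : K :=
  \sum_(i < k.+1) \sum_(j < l.+1) a i j * b (k - i)%N (l - j)%N.

(** Cutting both factors to a square of side [n] makes the product of their partial sums an exact
    partial sum of the Cauchy product, of side [n + n]. *)
Definition trunc (K : pzRingType) (n : nat) (a : nat -> nat -> K) (k l : nat) : K :=
  if (k < n)%N && (l < n)%N then a k l else 0.

(** * Evaluation along multiplicative weights *)

Section Weights.
Variable m : nat.
Variable W : nat -> nat -> 'M[Cplx R]_m.+1.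
Hypothesis WD : forall k l k' l', W (k + k') (l + l') = W k l * W k' l'.
Hypothesis Wgeo : forall i j, geo_bounded (fun k l => W k l i j).

Definition evals a (X : 'M[Cplx R]_m.+1) :=
  forall i j, wsum a (fun k l => W k l i j) @ \oo --> X i j.

Lemma wsum_mx a n i j :
  wsum a (fun k l => W k l i j) n = psum (fun k l => a k l *: W k l) n i j.
Proof.
rewrite /wsum /psum summxE; apply: eq_bigr => k _.
by rewrite summxE; apply: eq_bigr => l _; rewrite mxE.
Qed.

Lemma evals_ex a : subexp a -> exists X, evals a X.
Proof.
move=> ha.
have h i j : exists S : Cplx R, wsum a (fun k l => W k l i j) @ \oo --> S.
  have [y [Y [yY h]]] := subexp_dsummable ha (Wgeo i j).
  by have [S aS _] := psum_cvg h yY; exists S.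
exists (\matrix_(i, j) xget 0 [set S : Cplx R | wsum a (fun k l => W k l i j) @ \oo --> S]).
by move=> i j; rewrite mxE; case: xgetP => [S _ //|nS]; have [S /nS] := h i j.
Qed.

Lemma psum_conv a b n :
  psum (fun k l => conv (trunc n a) (trunc n b) k l *: W k l) (n + n) =
  psum (fun k l => a k l *: W k l) n * psum (fun k l => b k l *: W k l) n.
Proof.
pose U i i' j j' := (trunc n a i j *: W i j) * (trunc n b i' j' *: W i' j').
transitivity (\sum_(k < n + n) \sum_(l < n + n)
    \sum_(i < k.+1) \sum_(j < l.+1) U i (k - i)%N j (l - j)%N).
  apply: eq_bigr => k _; apply: eq_bigr => l _; rewrite scaler_suml.
  apply: eq_bigr => i _; rewrite scaler_suml; apply: eq_bigr => j _.
  by rewrite /U -scalerAl -scalerAr scalerA -WD !subnKC// -ltnS.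
transitivity (\sum_(k < n + n) \sum_(i < k.+1)
    \sum_(j < n) \sum_(j' < n) U i (k - i)%N j j').
  apply: eq_bigr => k _; rewrite exchange_big /=; apply: eq_bigr => i _.
  apply: (@sum_conv _ (U i (k - i)%N)) => j j'.
  rewrite negb_and => /orP[] h; rewrite /U /trunc (negbTE h) ?andbF scale0r.
    by rewrite mul0r.
  by rewrite mulr0.
rewrite (@sum_conv _ (fun i i' => \sum_(j < n) \sum_(j' < n) U i i' j j')).
  have tr c : psum (fun k l => c k l *: W k l) n =
      \sum_(k < n) \sum_(l < n) trunc n c k l *: W k l.
    by apply: eq_bigr => k _; apply: eq_bigr => l _; rewrite /trunc !ltn_ord.
  rewrite !tr mulr_suml; apply: eq_bigr => i _.
  rewrite mulr_sumr; apply: eq_bigr => i' _.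
  rewrite mulr_suml; apply: eq_bigr => j _.
  by rewrite mulr_sumr.
move=> i i'; rewrite negb_and => h; rewrite big1// => j _; rewrite big1// => j' _.
by case/orP: h => h; rewrite /U /trunc (negbTE h) /= scale0r ?mul0r ?mulr0.
Qed.

End Weights.

(** The Cauchy product of the arrays of moduli majorises the products of all truncations. The values
    remain complex so that [conv] and [subexp] apply to it. *)
Definition nrm_arr a : nat -> nat -> Cplx R := fun k l => (nrm (a k l))%:C%C.

Lemma subexp_nrm_arr a : subexp a -> subexp (nrm_arr a).
Proof.
move=> ha r r0 r1; have [D D0 hD] := ha r r0 r1; exists D => // k l.
by rewrite nrm_real ger0_norm ?nrm_ge0.
Qed.

Lemma conv_nrm_arr a b k l : conv (nrm_arr a) (nrm_arr b) k l =
  (\sum_(i < k.+1) \sum_(j < l.+1) nrm (a i j) * nrm (b (k - i)%N (l - j)%N))%:C%C.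
Proof.
rewrite rmorph_sum /=; apply: eq_bigr => i _.
by rewrite rmorph_sum /=; apply: eq_bigr => j _; rewrite rmorphM.
Qed.

Lemma nrm_conv_le a b a' b' k l :
  (forall i j, nrm (a i j) <= nrm (a' i j)) -> (forall i j, nrm (b i j) <= nrm (b' i j)) ->
  nrm (conv a b k l) <= nrm (conv (nrm_arr a') (nrm_arr b') k l).
Proof.
move=> aa bb; rewrite conv_nrm_arr nrm_real ger0_norm; last first.
  by apply: sumr_ge0 => i _; apply: sumr_ge0 => j _; rewrite mulr_ge0 ?nrm_ge0.
rewrite (le_trans (ler_nrm_sum _ _ _))//; apply: ler_sum => i _.
rewrite (le_trans (ler_nrm_sum _ _ _))//; apply: ler_sum => j _.
by rewrite nrmM ler_pM ?nrm_ge0.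
Qed.

(** At a radius [s] between [r] and 1 each term of the product is at most [D E / s^(k+l)]. There are
    [(k+1)(l+1)] of them, a number that [(r/s)^(k+l)] absorbs. *)
Lemma subexp_conv a b : subexp a -> subexp b -> subexp (conv a b).
Proof.
move=> ha hb r r0 r1.
pose s := (1 + r) / 2.
have s0 : 0 < s by rewrite /s; lra.
have s1 : s < 1 by rewrite /s; lra.
have rs : r < s by rewrite /s; lra.
have [D D0 hD] := ha s s0 s1; have [E E0 hE] := hb s s0 s1.
pose q := r / s.
have q0 : 0 <= q by rewrite divr_ge0// ltW.
have q1 : q < 1 by rewrite ltr_pdivrMr// mul1r.
exists (D * E * ((1 - q)^-1 * (1 - q)^-1)).
  by rewrite !mulr_ge0// invr_ge0 subr_ge0 ltW.
move=> k l.
have le1 : nrm (conv a b k l) <= (D * E / s ^+ (k + l)) * (k.+1%:R * l.+1%:R).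
  rewrite (le_trans (ler_nrm_sum _ _ _))//.
  rewrite (@le_trans _ _ (\sum_(i < k.+1) \sum_(j < l.+1) D * E / s ^+ (k + l)))//.
    apply: ler_sum => i _; rewrite (le_trans (ler_nrm_sum _ _ _))//.
    apply: ler_sum => j _; rewrite nrmM ler_pdivlMr ?exprn_gt0//.
    have -> : (k + l = (i + j) + ((k - i) + (l - j)))%N.
      by rewrite addnACA !subnKC// -ltnS.
    by rewrite exprD mulrACA ler_pM// mulr_ge0 ?nrm_ge0// exprn_ge0// ltW.
  by rewrite !sumr_const !card_ord -mulrnA -[leLHS]mulr_natr natrM (mulrC l.+1%:R).
apply: (le_trans (ler_wpM2r _ le1)); first by rewrite exprn_ge0// ltW.
rewrite [leLHS](_ : _ = D * E * ((k.+1%:R * q ^+ k) * (l.+1%:R * q ^+ l))).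
  rewrite ler_wpM2l ?mulr_ge0// ler_pM ?exp_natr_le// mulr_ge0// exprn_ge0//.
rewrite /q !expr_div_n !exprD; field.
by rewrite !expf_neq0 ?pnatr_eq0// gt_eqF// addr_gt0.
Qed.

Lemma nrm_trunc_le n a i j : nrm (trunc n a i j) <= nrm (a i j).
Proof. by rewrite /trunc; case: ifP => // _; rewrite nrm0 nrm_ge0. Qed.

Section WeightsMul.
Variable m : nat.
Variable W : nat -> nat -> 'M[Cplx R]_m.+1.
Hypothesis WD : forall k l k' l', W (k + k') (l + l') = W k l * W k' l'.
Hypothesis Wgeo : forall i j, geo_bounded (fun k l => W k l i j).

(** The product [P n] of the square partial sums tends entrywise to [X * Y]. It is also a partial
    sum for the truncated arrays, dominated uniformly in [n] by the product of moduli, so it tends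
    to the sum for [conv a b] as well. *)
Lemma evals_conv a b X Y : subexp a -> subexp b ->
  evals W a X -> evals W b Y -> evals W (conv a b) (X * Y).
Proof.
move=> ha hb aX bY i j.
have hc := subexp_conv (subexp_nrm_arr ha) (subexp_nrm_arr hb).
have [y [Y0 [yY h]]] := subexp_dsummable hc (Wgeo i j).
have dom (c : nat -> nat -> Cplx R) :
    (forall k l, nrm (c k l) <= nrm (conv (nrm_arr a) (nrm_arr b) k l)) ->
    forall k l, nrm (c k l * W k l i j) <= y k l.
  move=> cc k l; apply: le_trans (h k l).
  by rewrite !nrmM ler_wpM2r ?nrm_ge0.
have [S cS St] := psum_cvg (dom _ (fun k l =>
  nrm_conv_le k l (fun _ _ => lexx _) (fun _ _ => lexx _))) yY.
pose P n := (psum (fun k l => a k l *: W k l) n * psum (fun k l => b k l *: W k l) n) i j.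
suff -> : (X * Y) i j = S by exact: cS.
have PXY : P @ \oo --> (X * Y) i j.
  rewrite /P (_ : (fun n => _) = fun n => \sum_h
      (wsum a (fun k l => W k l i h) n * wsum b (fun k l => W k l h j) n)).
    rewrite [(X * Y) i j]mxE; apply: cvgC_sum => h' _.
    by apply: cvgM; [exact: aX|exact: bY].
  by apply/funext => n; rewrite mxE; apply: eq_bigr => h' _; rewrite !wsum_mx.
suff : P @ \oo --> S by exact: cvgC_unique PXY.
apply: (@tannery R P (fun n k l => conv (trunc n a) (trunc n b) k l * W k l i j)
  S (fun k l => conv a b k l * W k l i j) (fun M => Y0 - psum y M)).
- exact: dsummable_tail yY.
- move=> n M Mn; rewrite /P -psum_conv// -wsum_mx.
  have dn := dom (conv (trunc n a) (trunc n b)) (fun k l =>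
    nrm_conv_le k l (nrm_trunc_le n a) (nrm_trunc_le n b)).
  apply: (le_trans (psum_dist dn (leq_trans Mn (leq_addr n n)))).
  by rewrite lerB// dsummable_le.
- exact: St.
(* Once [n] exceeds [k] and [l], truncation no longer affects the coefficient of index [(k, l)]. *)
- move=> k l; apply: cvg_near_cst; exists (maxn k l).+1 => // n /=.
  rewrite gtn_max => /andP[kn ln]; congr (_ * _).
  apply: eq_bigr => i' _; apply: eq_bigr => j' _; rewrite /trunc.
  have in' : (i' < n)%N by apply: leq_ltn_trans kn; rewrite -ltnS.
  have jn' : (j' < n)%N by apply: leq_ltn_trans ln; rewrite -ltnS.
  have kin : (k - i' < n)%N by apply: leq_ltn_trans kn; exact: leq_subr.
  have ljn : (l - j' < n)%N by apply: leq_ltn_trans ln; exact: leq_subr.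
  by rewrite in' jn' kin ljn.
Qed.

End WeightsMul.

(** Evaluation at a point is the case of matrices of size one, with the monomials as weights. *)
Lemma expands_mul (f g : Cplx R * Cplx R -> Cplx R) a b : expands f a -> expands g b ->
  expands (fun z => f z * g z) (conv a b).
Proof.
move=> [ha fa] [hb gb]; split; first exact: subexp_conv.
move=> z bz; pose W k l : 'M[Cplx R]_1 := (monom z k l)%:M.
have We i j : (fun k l => W k l i j) = monom z.
  by apply/funext => k; apply/funext => l; rewrite mxE !ord1 eqxx mulr1n.
have ev c (x : Cplx R) : wsum c (monom z) @ \oo --> x -> evals W c x%:M.
  by move=> h i j; rewrite We mxE !ord1 eqxx mulr1n.
have := @evals_conv 0 W _ _ a b _ _ ha hb (ev _ _ (fa z bz)) (ev _ _ (gb z bz)).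
rewrite -[_%:M * _]scalar_mxM /evals.
move=> /(_ _ _ ord0 ord0); rewrite We mxE eqxx mulr1n; apply.
  by move=> k l k' l'; rewrite /W -[RHS]scalar_mxM /monom !exprD mulrACA.
by move=> i j; rewrite We; exact: geo_bounded_monom.
Qed.

End Multiplicativity.

(** * Decay of matrix powers *)

Section MatrixPowers.
Variable R : realType.
Local Notation C := (Cplx R).

Lemma geo_boundedD (u v : nat -> nat -> C) : geo_bounded u -> geo_bounded v ->
  geo_bounded (fun k l => u k l + v k l).
Proof.
move=> [K [r [K0 r0 r1 hu]]] [L [s [L0 s0 s1 hv]]].
exists (K + L), (Num.max r s); split; rewrite ?addr_ge0 ?le_max ?r0 ?gt_max ?r1//.
move=> k l; rewrite (le_trans (ler_nrmD _ _))// mulrDl lerD//.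
  apply: (le_trans (hu k l)); rewrite ler_wpM2l// lerXn2r ?nnegrE ?le_max ?lexx ?r0//.
apply: (le_trans (hv k l)).
by rewrite ler_wpM2l// lerXn2r ?nnegrE ?le_max ?lexx ?r0 ?orbT.
Qed.

Lemma geo_bounded_sum (I : Type) (s : seq I) (u : I -> nat -> nat -> C) :
  (forall i, geo_bounded (u i)) -> geo_bounded (fun k l => \sum_(i <- s) u i k l).
Proof.
move=> hu; elim: s => [|i s IH].
  exists 0, 0; split=> // k l; rewrite big_nil nrm0 mul0r//.
rewrite (_ : (fun k l => _) = fun k l => u i k l + \sum_(i <- s) u i k l).
  exact: geo_boundedD.
by apply/funext => k; apply/funext => l; rewrite big_cons.
Qed.

Definition geo_decay (u : nat -> C) := exists K r : R,
  [/\ 0 <= K, 0 <= r, r < 1 & forall k, nrm (u k) <= K * r ^+ k].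

Lemma geo_boundedM (u v : nat -> C) : geo_decay u -> geo_decay v ->
  geo_bounded (fun k l => u k * v l).
Proof.
move=> [K [r [K0 r0 r1 hu]]] [L [s [L0 s0 s1 hv]]].
exists (K * L), (Num.max r s); split; rewrite ?mulr_ge0 ?le_max ?r0 ?gt_max ?r1//.
move=> k l; rewrite nrmM exprD mulrACA ler_pM ?nrm_ge0//.
  apply: (le_trans (hu k)); rewrite ler_wpM2l// lerXn2r ?nnegrE ?le_max ?lexx ?r0//.
apply: (le_trans (hv l)).
by rewrite ler_wpM2l// lerXn2r ?nnegrE ?le_max ?lexx ?r0 ?orbT.
Qed.

(** * Eigenvalues and decay, by peeling off linear factors *)

Variable m : nat.
Implicit Types (M A B : 'M[R[i]]_m.+1) (x : 'cV[R[i]]_m.+1) (s : seq R[i]).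

(** Inductions on the list [s] of roots take the place of a triangular or Jordan form: applying
    [M - c] to [x] removes [c] from the list. *)
Definition kills s M x := horner_mx M (\prod_(c <- s) ('X - c%:P)) *m x = 0.

Lemma kills_cons c s M x : kills (c :: s) M x -> kills s M (M *m x - c *: x).
Proof.
rewrite /kills big_cons mulrC rmorphM /= -mulmxA => <-; congr (_ *m _).
by rewrite rmorphB /= horner_mx_X horner_mx_C mulmxBl mul_scalar_mx.
Qed.

Lemma kills_nil M x : kills [::] M x -> x = 0.
Proof. by rewrite /kills big_nil rmorph1 mul1mx. Qed.

(** The characteristic polynomial splits over the complex numbers, and Cayley-Hamilton says that it
    annihilates every vector. *)
Lemma kills_roots M : exists2 s, forall c, c \in s -> root (char_poly M) c &
  forall x, kills s M x.
Proof.
have [s sE] := closed_field_poly_normal (char_poly M).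
rewrite (monicP (char_poly_monic M)) scale1r in sE.
exists s => [c cs|x]; first by rewrite sE root_prod_XsubC.
by rewrite /kills -sE Cayley_Hamilton mul0mx.
Qed.

(* If [M x = c x + y] and [M^k y] is [O(q^k)], then [M^k x] is [O(r^k)] for any
   [r > max |c| q]. *)
Lemma kills_decay s M x i : (forall c, c \in s -> nrm (c : C) < 1) -> kills s M x ->
  geo_decay (fun k => (M ^+ k *m x) i ord0).
Proof.
elim: s x => [|c s IH] x sc.
  by move=> /kills_nil ->; exists 0, 0; split=> // k; rewrite mulmx0 mxE nrm0 mul0r.
move=> /kills_cons /(IH _ _)[|K [q [K0 q0 q1 hK]]].
  by move=> d ds; apply: sc; rewrite inE ds orbT.
have c1 : nrm (c : C) < 1 by apply: sc; rewrite inE eqxx.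
set t := Num.max q (nrm (c : C)).
have t1 : t < 1 by rewrite gt_max q1.
have qt : q <= t by rewrite le_max lexx.
have ct : nrm (c : C) <= t by rewrite le_max lexx orbT.
pose r := (1 + t) / 2.
have tr : t < r by rewrite /r; lra.
have r1 : r < 1 by rewrite /r; lra.
have t0 : 0 <= t by exact: le_trans qt.
have r0 : 0 <= r by lra.
(* The inductive step requires [K + t L <= L r], which the second summand provides; the first covers
   [k = 0]. *)
pose L := nrm (x i ord0 : C) + K / (r - t).
have KL : K <= L * (r - t).
  by rewrite -ler_pdivrMr ?subr_gt0// lerDr nrm_ge0.
have L0 : 0 <= L by rewrite addr_ge0 ?nrm_ge0// divr_ge0// subr_ge0 ltW.
exists L, r; split=> //; elim=> [|k IHk].
  by rewrite expr0 mul1mx expr0 mulr1 lerDl divr_ge0// subr_ge0 ltW.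
have -> : (M ^+ k.+1 *m x) i ord0 =
    (M ^+ k *m (M *m x - c *: x)) i ord0 + c * (M ^+ k *m x) i ord0.
  by rewrite mulmxBr -scalemxAr exprSr -mulmxE -mulmxA !mxE subrK.
apply: (le_trans (ler_nrmD _ _)); rewrite (nrmM (c : C)).
have h1 : nrm (c : C) * nrm ((M ^+ k *m x) i ord0 : C) <= t * (L * r ^+ k).
  by rewrite ler_pM ?nrm_ge0.
have h2 : nrm ((M ^+ k *m (M *m x - c *: x)) i ord0 : C) <= K * r ^+ k.
  apply: (le_trans (hK k)); rewrite ler_wpM2l// lerXn2r ?nnegrE//; lra.
apply: (le_trans (lerD h2 h1)).
rewrite exprS [leRHS](_ : _ = L * (r - t) * r ^+ k + t * (L * r ^+ k)); last by ring.
by rewrite lerD2r ler_wpM2r// exprn_ge0.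
Qed.

(** The eigenspace of [A] is stable under [B]. Either [B x = c x], or [B x - c x] is a new
    eigenvector of [A] with the same eigenvalue, killed by one factor fewer. *)
Lemma joint_eigenvector A B x a : comm_mx A B -> x != 0 -> A *m x = a *: x ->
  exists b (y : 'cV_m.+1), [/\ y != 0, A *m y = a *: y & B *m y = b *: y].
Proof.
move=> AB; have [s _ /(_ x)] := kills_roots B.
elim: s x => [|c s IH] x.
  by move=> /kills_nil -> /eqP.
move=> /kills_cons h x0 Ax.
have [/eqP e|y0] := eqVneq (B *m x - c *: x) 0.
  by exists c, x; split=> //; apply/eqP; rewrite -subr_eq0.
apply: (IH _ h y0); rewrite mulmxBr mulmxA AB -mulmxA Ax -!scalemxAr.
by rewrite Ax scalerBr !scalerA mulrC.
Qed.

(** [eigenvalue] speaks of row vectors, hence the passage to the transpose, which has the same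
    characteristic polynomial. *)
Lemma root_char_poly_col M c : root (char_poly M) c ->
  exists2 x : 'cV_m.+1, x != 0 & M *m x = c *: x.
Proof.
have -> : char_poly M = char_poly M^T.
  by rewrite /char_poly -det_tr; congr (\det _);
    rewrite /char_poly_mx linearB /= tr_scalar_mx map_trmx.
rewrite -eigenvalue_root_char => /eigenvalueP[v vM v0].
exists v^T; first by rewrite trmx_eq0.
by rewrite -[M]trmxK -trmx_mul vM linearZ.
Qed.

End MatrixPowers.

(** * The functional calculus *)

Section FunctionalCalculus.
Variable R : realType.
Variable m : nat.
Variable M : mxpair R m.
Hypothesis M_comm : comm_mx M.1 M.2.
Hypothesis M_spec : joint_spectrum M `<=` @bidisc R.

Definition mxweight k l : 'M[Cplx R]_m.+1 := M.1 ^+ k * M.2 ^+ l.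

Lemma mxweightD k l k' l' :
  mxweight (k + k') (l + l') = mxweight k l * mxweight k' l'.
Proof.
have c : GRing.comm (M.1 ^+ k') (M.2 ^+ l) by apply/commrX/commr_sym/commrX/commr_sym.
by rewrite /mxweight !exprD mulrA -(mulrA _ _ (M.2 ^+ l)) c !mulrA.
Qed.

(** By commutation each eigenvalue of one matrix is a coordinate of a joint eigenvalue, hence of
    modulus below 1. So the entries of the powers of both matrices decay geometrically. *)
Lemma mxweight_geo i j : geo_bounded (fun k l => mxweight k l i j).
Proof.
have dec (A B : 'M[Cplx R]_m.+1) (p : Cplx R * Cplx R -> Cplx R) : comm_mx A B ->
    (forall a b (y : 'cV_m.+1), y != 0 -> A *m y = a *: y -> B *m y = b *: y -> nrm a < 1) ->
    forall i j, geo_decay (fun k => (A ^+ k) i j).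
  move=> AB spec {}i {}j; have [s sr /(_ (delta_mx j ord0 : 'cV_m.+1)) sk] :=
    kills_roots (A : 'M[R[i]]_m.+1).
  have := @kills_decay _ _ s A (delta_mx j ord0 : 'cV_m.+1) i _ sk.
  rewrite (_ : (fun k => _) = (fun k => (A ^+ k) i j)); last first.
    by apply/funext => k; rewrite -colE mxE.
  apply=> c /sr /root_char_poly_col[x x0 Ax].
  have [b [y [y0 Ay By]]] := joint_eigenvector AB x0 Ax.
  exact: spec y0 Ay By.
have d1 : forall i j, geo_decay (fun k => (M.1 ^+ k) i j).
  apply: (dec _ M.2) => // [|a b y y0 ay by']; first exact: fst.
  have : bidisc (a, b) by apply: M_spec; exists y; split.
  by move=> /bidiscP[].
have d2 : forall i j, geo_decay (fun k => (M.2 ^+ k) i j).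
  apply: (dec _ M.1) => // [|a b y y0 ay by']; first exact: fst.
  have : bidisc (b, a) by apply: M_spec; exists y; split.
  by move=> /bidiscP[].
rewrite (_ : (fun k l => _) = fun k l => \sum_h (M.1 ^+ k) i h * (M.2 ^+ l) h j).
  by apply: geo_bounded_sum => h; exact: geo_boundedM.
by apply/funext => k; apply/funext => l; rewrite mxE.
Qed.

Lemma cvg_mx (u : nat -> 'M[Cplx R]_m.+1) (X : 'M[Cplx R]_m.+1) :
  (forall i j, u n i j @[n --> \oo] --> X i j) -> u @ \oo --> X.
Proof.
move=> h; apply/cvg_mx_entourageP => A entA.
apply: filter_forall => i; apply: filter_forall => j.
have /cvg_app_entourageP /(_ _ entA) := h i j.
by apply: (@filterS _ \oo) => n Aij; exact: mem_set.
Qed.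

Lemma fun_calculusE f a X : expands f a -> evals mxweight a X ->
  fun_calculus f M = X.
Proof.
move=> fa aX; rewrite /fun_calculus (expands_coef fa).
apply: cvg_lim; first exact: norm_hausdorff.
apply: cvg_mx => i j.
rewrite (_ : (fun n => _) = wsum a (fun k l => mxweight k l i j)); first exact: aX.
by apply/funext => n; rewrite wsum_mx.
Qed.

Lemma evals_fun_calculus f a : expands f a -> evals mxweight a (fun_calculus f M).
Proof.
move=> fa; have [X aX] := evals_ex mxweight_geo fa.1.
by rewrite (fun_calculusE fa aX).
Qed.

Lemma fun_calculus_no_expansion f : ~ (exists a, expands f a) -> fun_calculus f M = 0.
Proof.
move=> nf; rewrite /fun_calculus (no_expansion_coef nf).
apply: cvg_lim; first exact: norm_hausdorff.
rewrite (_ : (fun n => _) = fun=> 0); first exact: cvg_cst.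
by apply/funext => n; rewrite big1// => k _; rewrite big1// => l _; rewrite scale0r.
Qed.

Definition analytic (f : Cplx R * Cplx R -> Cplx R) := exists a, expands f a.

Lemma fun_calculusM f g : analytic f -> analytic g ->
  fun_calculus (fun z => f z * g z) M = fun_calculus f M * fun_calculus g M.
Proof.
move=> [a fa] [b gb]; apply: (fun_calculusE (expands_mul fa gb)).
apply: (evals_conv mxweightD mxweight_geo fa.1 gb.1); exact: evals_fun_calculus.
Qed.

End FunctionalCalculus.

(** * Sums of analytic functions *)

Section AnalyticFunctions.
Variable R : realType.
Implicit Types (a : nat -> nat -> Cplx R) (f g : Cplx R * Cplx R -> Cplx R).

Lemma wsumD a b w :
  wsum (fun k l => a k l + b k l) w = fun N => wsum a w N + wsum b w N.
Proof.
apply/funext => N.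
rewrite /wsum /psum -big_split /=; apply: eq_bigr => k _.
by rewrite -big_split /=; apply: eq_bigr => l _; rewrite mulrDl.
Qed.

Lemma wsumZ (c : Cplx R) a w :
  wsum (fun k l => c * a k l) w = fun N => c * wsum a w N.
Proof.
apply/funext => N.
rewrite /wsum /psum mulr_sumr; apply: eq_bigr => k _.
by rewrite mulr_sumr; apply: eq_bigr => l _; rewrite mulrA.
Qed.

Lemma subexpZ (c : Cplx R) a : subexp a -> subexp (fun k l => c * a k l).
Proof.
move=> ha r r0 r1; have [D D0 hD] := ha r r0 r1.
exists (nrm c * D); first by rewrite mulr_ge0 ?nrm_ge0.
by move=> k l; rewrite nrmM -mulrA ler_wpM2l ?nrm_ge0.
Qed.

Lemma subexpD a b : subexp a -> subexp b -> subexp (fun k l => a k l + b k l).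
Proof.
move=> ha hb; have := subexpB ha (subexpZ (-1) hb).
by congr subexp; apply/funext => k; apply/funext => l; rewrite mulN1r opprK.
Qed.

Lemma eq_expands f g a b : (forall z, g z = f z) -> (forall k l, b k l = a k l) ->
  expands f a -> expands g b.
Proof.
move=> /funext -> ab; suff -> : b = a by [].
by apply/funext => k; apply/funext => l.
Qed.

Lemma expandsD f g a b : expands f a -> expands g b ->
  expands (fun z => f z + g z) (fun k l => a k l + b k l).
Proof.
move=> [ha fa] [hb gb]; split=> [|z bz]; first exact: subexpD.
by rewrite wsumD; apply: cvgD; [exact: fa|exact: gb].
Qed.

Lemma expandsZ (c : Cplx R) f a : expands f a ->
  expands (fun z => c * f z) (fun k l => c * a k l).
Proof.
move=> [ha fa]; split=> [|z bz]; first exact: subexpZ.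
by rewrite wsumZ; apply: cvgM; [exact: cvg_cst|exact: fa].
Qed.

Definition coef1 (k l : nat) : Cplx R := if (k == 0%N) && (l == 0%N) then 1 else 0.

Lemma wsum_coef1 w N : wsum coef1 w N.+1 = w 0%N 0%N.
Proof.
rewrite /wsum /psum big_ord_recl big_ord_recl /= /coef1 /= mul1r.
rewrite big1 ?addr0 => [|l _]; last by rewrite mul0r.
by rewrite big1 ?addr0// => k _; rewrite big1// => l _; rewrite mul0r.
Qed.

Lemma cvg_wsum_coef1 w : wsum coef1 w @ \oo --> w 0%N 0%N.
Proof.
apply: cvg_near_cst; exists 1%N => // -[//|N] _; exact: wsum_coef1.
Qed.

Lemma expands1 : expands (fun=> 1) coef1.
Proof.
split=> [|z bz].
  by apply: (@bounded_subexp _ _ 1) => k l; rewrite /coef1; case: ifP; rewrite ?nrm1 ?nrm0.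
by have := @cvg_wsum_coef1 (monom z); rewrite /monom !expr0 mulr1.
Qed.

Lemma analytic_cst (c : Cplx R) : analytic (fun=> c).
Proof.
exists (fun k l => c * coef1 k l).
by apply: eq_expands (expandsZ c expands1) => [z|//]; rewrite mulr1.
Qed.

Lemma analyticD f g : analytic f -> analytic g -> analytic (fun z => f z + g z).
Proof. by move=> [a fa] [b gb]; eexists; exact: expandsD fa gb. Qed.

Lemma analyticM f g : analytic f -> analytic g -> analytic (fun z => f z * g z).
Proof. by move=> [a fa] [b gb]; eexists; exact: expands_mul fa gb. Qed.

Lemma analyticX f n : analytic f -> analytic (fun z => f z ^+ n).
Proof.
move=> fa; elim: n => [|n IH]; first exact: analytic_cst.
by under eq_fun do rewrite exprS; exact: analyticM fa IH.
Qed.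

Lemma analytic_prod (s : seq nat) (F : nat -> Cplx R * Cplx R -> Cplx R) :
  (forall j, analytic (F j)) -> analytic (fun z => \prod_(j <- s) F j z).
Proof.
move=> hF; elim: s => [|j s IH].
  by under eq_fun do rewrite big_nil; exact: analytic_cst.
by under eq_fun do rewrite big_cons; exact: analyticM (hF j) IH.
Qed.

Lemma expands_sum (s : seq nat) (F : nat -> Cplx R * Cplx R -> Cplx R)
    (a : nat -> nat -> nat -> Cplx R) : (forall j, expands (F j) (a j)) ->
  expands (fun z => \sum_(j <- s) F j z) (fun k l => \sum_(j <- s) a j k l).
Proof.
move=> hF; elim: s => [|j s IH].
  by apply: eq_expands (expandsZ 0 expands1) => [z|k l]; rewrite big_nil mul0r.
by apply: eq_expands (expandsD (hF j) IH) => [z|k l]; rewrite big_cons.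
Qed.

Section OneMatrix.
Variables (m : nat) (M : mxpair R m).
Hypothesis M_comm : comm_mx M.1 M.2.
Hypothesis M_spec : joint_spectrum M `<=` @bidisc R.

Lemma fun_calculusD f g : analytic f -> analytic g ->
  fun_calculus (fun z => f z + g z) M = fun_calculus f M + fun_calculus g M.
Proof.
move=> [a fa] [b gb]; apply: (fun_calculusE (expandsD fa gb)) => i j.
rewrite mxE; rewrite wsumD.
by apply: cvgD; apply: evals_fun_calculus.
Qed.

Lemma fun_calculus_cst (c : Cplx R) : fun_calculus (fun=> c) M = c%:M.
Proof.
have e : expands (fun=> c) (fun k l => c * coef1 k l).
  by apply: eq_expands (expandsZ c expands1) => [z|//]; rewrite mulr1.
apply: (fun_calculusE e) => i j; rewrite wsumZ.
rewrite (_ : c%:M i j = c * mxweight M 0 0 i j); last first.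
  by rewrite /mxweight !expr0 mulr1 !mxE mulr_natr.
by apply: cvgM; [exact: cvg_cst|exact: cvg_wsum_coef1].
Qed.

Lemma fun_calculusX f n : analytic f ->
  fun_calculus (fun z => f z ^+ n) M = fun_calculus f M ^+ n.
Proof.
move=> fa; elim: n => [|n IH]; first by rewrite fun_calculus_cst.
under [X in fun_calculus X]eq_fun do rewrite exprS.
by rewrite exprS -IH; exact: fun_calculusM fa (analyticX n fa).
Qed.

End OneMatrix.

(** * Series of analytic functions with bounded sums of moduli *)

Lemma abs_series_cvg (x : nat -> Cplx R) (B : R) :
  (forall N, \sum_(n < N) nrm (x n) <= B) ->
  exists S : Cplx R, \sum_(n < N) x n @[N --> \oo] --> S.
Proof.
move=> xB; pose t N := \sum_(n < N) nrm (x n).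
have tnd : nondecreasing_seq t.
  by apply/nondecreasing_seqP => N; rewrite /t big_ord_recr /= lerDl nrm_ge0.
have tc : cvgn t.
  by apply: nondecreasing_is_cvgn => //; exists B => _ [N _ <-]; exact: xB.
have [||S hS _] := @cvg_tail _ (fun N => \sum_(n < N) x n) (fun N => limn t - t N);
  last by exists S.
- move=> N N' NN'; apply: (@le_trans _ _ (t N' - t N)).
    rewrite /t -!(big_mkord xpredT x) -!(big_mkord xpredT (fun n => nrm (x n))).
    rewrite !(big_cat_nat (leq0n N) NN') /= addrAC subrr add0r addrAC subrr add0r.
    exact: ler_nrm_sum.
  by rewrite lerB// nondecreasing_cvgn_le.
- by rewrite -(subrr (limn t)); apply: cvgB => //; exact: cvg_cst.
Qed.

(* Replacing [g n] by [e n * g n] with [e n] of modulus at most 1 does not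
   affect the hypothesis, so Cauchy's estimate bounds [\sum_n nrm (a n k l)]. *)
Lemma sum_coef_le (g : nat -> Cplx R * Cplx R -> Cplx R)
    (a : nat -> nat -> nat -> Cplx R) (B : R) N k l :
  (forall n, expands (g n) (a n)) ->
  (forall z, bidisc z -> \sum_(n < N) nrm (g n z) <= B) ->
  \sum_(n < N) nrm (a n k l) <= B.
Proof.
move=> ga gB.
pose e n : Cplx R := if a n k l == 0 then 0 else (nrm (a n k l))%:C%C / a n k l.
have e1 n : nrm (e n) <= 1.
  rewrite /e; case: eqP => [_|/eqP a0]; first by rewrite nrm0.
  rewrite nrmM nrmV nrm_real ger0_norm ?nrm_ge0// mulfV//.
  by apply: contra a0 => /eqP/nrm0_eq0 ->.
have ea n : e n * a n k l = (nrm (a n k l))%:C%C.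
  by rewrite /e; case: eqP => [->|/eqP a0]; rewrite ?nrm0 ?mul0r// divfK.
have h := expands_sum (index_iota 0 N) (fun n => expandsZ (e n) (ga n)).
have := @cauchy_estimate _ _ _ B h _ k l.
rewrite (eq_bigr _ (fun n _ => ea n)) -rmorph_sum nrm_real ger0_norm; last first.
  by apply: sumr_ge0 => n _; exact: nrm_ge0.
rewrite big_mkord; apply=> z /gB; apply: le_trans.
rewrite big_mkord (le_trans (ler_nrm_sum _ _ _))//; apply: ler_sum => n _.
by rewrite nrmM ler_piMl// nrm_ge0.
Qed.

(** Cauchy estimates bound the sums of moduli of the coefficients by [B], so the coefficients of the
    partial sums converge and share the bound [B]. This majorant permits the exchange of limits
    against any geometrically bounded weight. *)
Lemma analytic_series (g : nat -> Cplx R * Cplx R -> Cplx R) (B : R) :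
  (forall n, analytic (g n)) ->
  (forall z N, bidisc z -> \sum_(n < N) nrm (g n z) <= B) ->
  exists f, [/\ analytic f,
    forall z, bidisc z -> nrm (f z) <= B,
    forall z, bidisc z -> \sum_(n < N) g n z @[N --> \oo] --> f z &
    forall m (M : mxpair R m), comm_mx M.1 M.2 -> joint_spectrum M `<=` @bidisc R ->
      forall i j, \sum_(n < N) fun_calculus (g n) M i j @[N --> \oo]
        --> fun_calculus f M i j].
Proof.
move=> /choice[a ga] gB.
have aB k l N : \sum_(n < N) nrm (a n k l) <= B.
  by apply: (sum_coef_le _ _ ga) => z /gB.
have /choice[c hc] (kl : nat * nat) : exists c : Cplx R,
    \sum_(n < N) a n kl.1 kl.2 @[N --> \oo] --> c.
  exact: (@abs_series_cvg (fun n => a n kl.1 kl.2) B (aB kl.1 kl.2)).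
have AB N k l : nrm (\sum_(n < N) a n k l) <= B.
  exact: le_trans (ler_nrm_sum _ _ _) (aB k l N).
have cB k l : nrm (c (k, l)) <= B.
  by apply: nrm_lim_le (hc (k, l)) => N; exact: AB.
have B0 : 0 <= B by exact: le_trans (nrm_ge0 _) (cB 0%N 0%N).
(* Stated for a general weight, to be used with the monomials at a point and with the matrix
   entries. *)
have lim w (E : nat -> Cplx R) : geo_bounded w ->
    (forall n, wsum (a n) w @ \oo --> E n) ->
    exists2 S : Cplx R, wsum (fun k l => c (k, l)) w @ \oo --> S &
      \sum_(n < N) E n @[N --> \oo] --> S.
  move=> [K [r [K0 r0 r1 hw]]] aE.
  have yY := dsummableZ (mulr_ge0 B0 K0) (dsummable_geo r0 r1).
  set y := (fun k l => _) in yY; set Y := (X in dsummable _ X) in yY.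
  have dom (b : nat -> nat -> Cplx R) : (forall k l, nrm (b k l) <= B) ->
      forall k l, nrm (b k l * w k l) <= y k l.
    by move=> bB k l; rewrite nrmM /y -mulrA ler_pM ?nrm_ge0.
  have [S cS St] := psum_cvg (dom (fun k l => c (k, l)) cB) yY.
  exists S; first exact: cS.
  apply: (@tannery R _ (fun N k l => (\sum_(n < N) a n k l) * w k l) S
    (fun k l => c (k, l) * w k l) (fun M => Y - psum y M)).
  - exact: dsummable_tail yY.
  - move=> N M _; apply: (psum_cvg_tail (dom _ (AB N)) yY).
    rewrite (_ : psum _ = fun q => \sum_(n < N) wsum (a n) w q).
      by apply: cvgC_sum => n _; exact: aE.
    apply/funext => q; rewrite /wsum /psum [RHS]exchange_big /=; apply: eq_bigr => k _.
    by rewrite [RHS]exchange_big /=; apply: eq_bigr => l _; rewrite mulr_suml.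
  - exact: St.
  - by move=> k l; apply: cvgM; [exact: (hc (k, l))|exact: cvg_cst].
pose f z : Cplx R := xget 0 [set S : Cplx R | wsum (fun k l => c (k, l)) (monom z) @ \oo --> S].
have fE z : bidisc z -> wsum (fun k l => c (k, l)) (monom z) @ \oo --> f z /\
    \sum_(n < N) g n z @[N --> \oo] --> f z.
  move=> bz; have [S cS gS] := lim _ _ (geo_bounded_monom bz) (fun n => (ga n).2 z bz).
  suff -> : f z = S by [].
  by rewrite /f; case: xgetP => [T _ cT|/(_ _ cS)//]; exact: cvgC_unique cT cS.
have fc : expands f (fun k l => c (k, l)).
  by split=> [|z /fE[]//]; exact: bounded_subexp cB.
exists f; split.
- by eexists; exact: fc.
- move=> z bz; apply: nrm_lim_le (fE z bz).2 => N.
  exact: le_trans (ler_nrm_sum _ _ _) (gB z N bz).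
- by move=> z /fE[].
- move=> m M Mc Ms i j.
  have ev (h : Cplx R * Cplx R -> Cplx R) b : expands h b ->
      wsum b (fun k l => mxweight M k l i j) @ \oo --> fun_calculus h M i j.
    by move=> hb; exact: evals_fun_calculus hb i j.
  have [S cS gS] := lim _ _ (mxweight_geo Mc Ms i j) (fun n => ev _ _ (ga n)).
  have e : S = fun_calculus f M i j := cvgC_unique cS (ev _ _ fc).
  by move: gS; rewrite e; exact: id.
Qed.

End AnalyticFunctions.

(** * Holomorphy of power series *)

Section Differentiability.
Variable R : realType.
Implicit Types (x h p q : Cplx R) (z w : Cplx R * Cplx R).

(** * Taylor remainders of powers and monomials *)

Section PowerRemainder.
Variables (x h : Cplx R) (r d t : R).
Hypotheses (xr : nrm x <= r) (hd : nrm h <= t * d).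
Hypotheses (d0 : 0 <= d) (t0 : 0 <= t) (t1 : t <= 1).

Local Lemma r_ge0 : 0 <= r. Proof. exact: le_trans (nrm_ge0 _) xr. Qed.

Local Lemma tdd : t * d <= d. Proof. by rewrite ler_piMl. Qed.

Lemma exprD_bound k : nrm ((x + h) ^+ k) <= (r + d) ^+ k.
Proof.
rewrite nrmX lerXn2r ?nnegrE ?nrm_ge0 ?addr_ge0 ?r_ge0//.
by rewrite (le_trans (ler_nrmD _ _))// lerD// (le_trans hd)// tdd.
Qed.

(** The scale [d] stays fixed, to be chosen with [r + d < 1], and the smallness of [h] is carried by
    [t] alone; the exponent of [t] is then the order of the remainder. *)
Lemma exprD_remainder0 k : nrm ((x + h) ^+ k - x ^+ k) <= t * (r + d) ^+ k.
Proof.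
elim: k => [|k IH]; first by rewrite subrr nrm0 mulr1.
rewrite (_ : _ - _ = x * ((x + h) ^+ k - x ^+ k) + h * (x + h) ^+ k); last first.
  by rewrite !exprS; ring.
rewrite (le_trans (ler_nrmD _ _))// !nrmM.
rewrite [leRHS](_ : _ = r * (t * (r + d) ^+ k) + t * d * (r + d) ^+ k); last first.
  by rewrite (exprS (r + d)); ring.
by rewrite lerD// ler_pM ?nrm_ge0// exprD_bound.
Qed.

(** From [k] to [k + 1] the remainder becomes [x] times itself plus [h] times the first difference,
    which is already of order [t]. *)
Lemma exprD_remainder1 k :
  nrm ((x + h) ^+ k - x ^+ k - (x ^+ k.-1 *+ k) * h) <= t ^+ 2 * (r + d) ^+ k.
Proof.
elim: k => [|k IH].
  by rewrite mulr0n mul0r subrr subr0 nrm0 mulr1 exprn_ge0.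
have dS : x ^+ k *+ k.+1 = x * (x ^+ k.-1 *+ k) + x ^+ k.
  by case: k {IH} => [|k]; rewrite ?mulr0n ?mulr0 ?add0r// mulrnAr -exprS -mulrSr.
rewrite /= dS (_ : _ - _ - _ = x * ((x + h) ^+ k - x ^+ k - (x ^+ k.-1 *+ k) * h) +
  h * ((x + h) ^+ k - x ^+ k)); last by rewrite !exprS; ring.
rewrite (le_trans (ler_nrmD _ _))// !nrmM.
rewrite [leRHS](_ : _ = r * (t ^+ 2 * (r + d) ^+ k) + t * d * (t * (r + d) ^+ k)); last first.
  by rewrite (exprS (r + d)); ring.
by rewrite lerD// ler_pM ?nrm_ge0// exprD_remainder0.
Qed.

(** The linear term is the difference of the two preceding remainders, which avoids estimating
    [k r^(k-1)] directly. *)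
Lemma deriv_bound k : nrm ((x ^+ k.-1 *+ k) * h) <= 2 * t * (r + d) ^+ k.
Proof.
have -> : (x ^+ k.-1 *+ k) * h = ((x + h) ^+ k - x ^+ k) -
    ((x + h) ^+ k - x ^+ k - (x ^+ k.-1 *+ k) * h) by ring.
rewrite (le_trans (ler_nrmB _ _))//.
have e1 := exprD_remainder0 k; have e2 := exprD_remainder1 k.
have : t ^+ 2 * (r + d) ^+ k <= t * (r + d) ^+ k.
  rewrite ler_wpM2r ?exprn_ge0 ?addr_ge0 ?r_ge0//.
  by rewrite expr2 ler_piMl.
by lra.
Qed.

End PowerRemainder.

(** The product rule leaves three terms, with constants 1, 2 and 1; their sum is the 4. *)
Lemma monom_remainder z w (r d t : R) k l :
  nrm z.1 <= r -> nrm z.2 <= r -> nrm w.1 <= t * d -> nrm w.2 <= t * d ->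
  0 <= d -> 0 <= t -> t <= 1 ->
  nrm (monom (z + w) k l - monom z k l -
    ((z.1 ^+ k.-1 *+ k) * z.2 ^+ l * w.1 + z.1 ^+ k * (z.2 ^+ l.-1 *+ l) * w.2))
  <= t ^+ 2 * (4 * (r + d) ^+ (k + l)).
Proof.
move=> z1 z2 w1 w2 d0 t0 t1; rewrite /monom -[(z + w).1]/(z.1 + w.1) -[(z + w).2]/(z.2 + w.2).
set A' := (z.1 + w.1) ^+ k; set B' := (z.2 + w.2) ^+ l.
set A := z.1 ^+ k; set B := z.2 ^+ l.
set dA := _ *+ k; set dB := _ *+ l.
rewrite (_ : _ - _ = (A' - A - dA * w.1) * B' + dA * w.1 * (B' - B) +
  A * (B' - B - dB * w.2)); last by ring.
have hA := exprD_remainder1 z1 w1 d0 t0 t1 k.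
have hB := exprD_remainder1 z2 w2 d0 t0 t1 l.
have hdA := deriv_bound z1 w1 d0 t0 t1 k.
have hB' := exprD_bound z2 w2 d0 t1 l.
have hBB := exprD_remainder0 z2 w2 d0 t0 t1 l.
have r0 : 0 <= r by exact: le_trans (nrm_ge0 _) z1.
have hA0 : nrm A <= (r + d) ^+ k.
  by rewrite /A nrmX lerXn2r ?nnegrE ?nrm_ge0 ?addr_ge0// (le_trans z1)// lerDl.
rewrite (le_trans (ler_nrmD _ _))//.
rewrite [leRHS](_ : _ = t ^+ 2 * (r + d) ^+ k * (r + d) ^+ l +
  2 * t * (r + d) ^+ k * (t * (r + d) ^+ l) +
  (r + d) ^+ k * (t ^+ 2 * (r + d) ^+ l)); last by rewrite exprD; ring.
rewrite lerD//; last by rewrite nrmM ler_pM ?nrm_ge0.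
rewrite (le_trans (ler_nrmD _ _))// lerD// nrmM ler_pM ?nrm_ge0//.
Qed.

Lemma differentiable_linear_approx (K : numFieldType) (V W : normedModType K)
    (f : V -> W) (df : {linear V -> W}) (x : V) : continuous df ->
  (forall eps : K, 0 < eps ->
    \forall h \near (0 : V), `|f (h + x) - (f x + df h)| <= eps * `|h|) ->
  differentiable f x.
Proof.
move=> dc H; have e : f \o shift x = cst (f x) + df +o_ 0 id.
  by apply/eqaddoP => eps eps0; exact: H.
by apply/diff_locallyP; rewrite (diff_unique dc e).
Qed.

Lemma differentiable_of_remainder (f : Cplx R * Cplx R -> Cplx R) z p q (d D : R) :
  0 < d -> 0 <= D ->
  (forall w t, 0 <= t -> t <= 1 -> nrm w.1 <= t * d -> nrm w.2 <= t * d ->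
    nrm (f (z + w) - f z - (p * w.1 + q * w.2)) <= D * t ^+ 2) ->
  differentiable f z.
Proof.
move=> d0 D0 H.
pose df w : Cplx R := p * w.1 + q * w.2.
have lin : linear df.
  move=> c u v; rewrite /df /= -[c *: u.1]/(c * u.1) -[c *: u.2]/(c * u.2).
  by rewrite -[c *: _]/(c * _); ring.
pose dfM := GRing.isLinear.Build _ _ _ _ _ lin.
pose dL : {linear (Cplx R * Cplx R)%type -> Cplx R} := HB.pack df dfM.
have dc : continuous dL.
  move=> u; rewrite /dL /= /df; apply: cvgD; apply: cvgM; try exact: cvg_cst.
    exact: cvg_fst.
  exact: cvg_snd.
apply: (@differentiable_linear_approx _ _ _ f dL) => // eps eps0.
  have eE : eps = (complex.Re eps)%:C%C.
    by move: eps0; rewrite ltcE /= => /andP[/eqP i0 _]; case: eps i0 => a b /= ->.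
  set e := complex.Re eps in eE.
  have e0 : 0 < e by rewrite -ltcR -eE.
  (* With [t = |w| / d] the remainder is [D |w|^2 / d^2], at most [e |w|] as soon as
     [|w| (D + 1) <= e d^2]. The denominator is [D + 1] because [D] may vanish. *)
  pose c := Num.min d (e * d ^+ 2 / (D + 1)).
  have c0 : 0 < c.
    by rewrite lt_min d0 divr_gt0 ?mulr_gt0 ?exprn_gt0// ltr_wpDl.
  apply/nbhs_ballP; exists c%:C%C; first by rewrite /= ltcR.
  move=> w; rewrite -ball_normE /= sub0r normrN => wc.
  have wE : `|w| = (Num.max (nrm w.1) (nrm w.2))%:C%C.
    rewrite prod_normE !normE; case: (leP (nrm w.1) (nrm w.2)) => h.
      by rewrite max_r ?lecR.
    by rewrite max_l ?lecR ?ltW.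
  set N := Num.max _ _ in wE.
  have N0 : 0 <= N by rewrite le_max nrm_ge0.
  move: wc; rewrite wE ltcR lt_min => /andP[Nd Ne].
  rewrite eE -rmorphM normE lecR /=.
  rewrite opprD addrA (addrC w).
  apply: (le_trans (H w (N / d) _ _ _ _)).
  - by rewrite divr_ge0// ltW.
  - by rewrite ler_pdivrMr// mul1r ltW.
  - by rewrite divfK ?gt_eqF// le_max lexx.
  - by rewrite divfK ?gt_eqF// le_max lexx orbT.
  rewrite expr_div_n mulrA ler_pdivrMr ?exprn_gt0// expr2.
  have : N * (D + 1) <= e * d ^+ 2 by rewrite -ler_pdivlMr ?ltW// ltr_wpDl.
  move=> h1; have : N * (N * (D + 1)) <= N * (e * d ^+ 2) by rewrite ler_wpM2l.
  have : 0 <= N * N by rewrite mulr_ge0.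
  by rewrite ?expr2; nra.
Qed.

(** Termwise differentiation: the differentiated monomials are again geometrically bounded weights,
    so [p] and [q] converge, and the second order remainders add up to at most [Y t^2]. *)
Lemma expands_holomorphic (f : Cplx R * Cplx R -> Cplx R) a :
  expands f a -> holomorphic f.
Proof.
move=> [ha fa] z bz; have /bidiscP[z1 z2] := bz.
pose r := Num.max (nrm z.1) (nrm z.2).
have r1 : r < 1 by rewrite gt_max z1.
have zr1 : nrm z.1 <= r by rewrite le_max lexx.
have zr2 : nrm z.2 <= r by rewrite le_max lexx orbT.
have r0 : 0 <= r by exact: le_trans (nrm_ge0 _) zr1.
pose d := (1 - r) / 2.
have d0 : 0 < d by rewrite /d; lra.
have s0 : 0 <= r + d by lra.
have s1 : r + d < 1 by rewrite /d; lra.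
(* This is [deriv_bound] for the increment [d] itself, with [t = 1], divided by [d]. *)
have dnrm x k : nrm x <= r -> nrm (x ^+ k.-1 *+ k) <= 2 / d * (r + d) ^+ k.
  move=> xr; have h : nrm (d%:C%C : Cplx R) <= 1 * d by rewrite nrm_real mul1r gtr0_norm.
  have := deriv_bound xr h (ltW d0) ler01 (lexx _) k.
  by rewrite mulr1 nrmM nrm_real gtr0_norm// mulrAC -ler_pdivlMr.
have xs x k : nrm x <= r -> nrm (x ^+ k) <= (r + d) ^+ k.
  by move=> xr; rewrite nrmX lerXn2r ?nnegrE ?nrm_ge0// (le_trans xr)// lerDl ltW.
have d2 : 0 <= 2 / d by rewrite divr_ge0// ltW.
pose w1 k l : Cplx R := (z.1 ^+ k.-1 *+ k) * z.2 ^+ l.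
pose w2 k l : Cplx R := z.1 ^+ k * (z.2 ^+ l.-1 *+ l).
have g1 : geo_bounded w1.
  exists (2 / d), (r + d); split=> // k l; rewrite nrmM exprD mulrA.
  by rewrite ler_pM ?nrm_ge0// ?dnrm ?xs.
have g2 : geo_bounded w2.
  exists (2 / d), (r + d); split=> // k l; rewrite nrmM exprD mulrCA.
  by rewrite ler_pM ?nrm_ge0// ?dnrm ?xs.
have [y1 [Y1 [yY1 h1]]] := subexp_dsummable ha g1.
have [y2 [Y2 [yY2 h2]]] := subexp_dsummable ha g2.
have [p ap _] := psum_cvg h1 yY1.
have [q aq _] := psum_cvg h2 yY2.
pose w0 k l : Cplx R := (4 * (r + d) ^+ (k + l))%:C%C.
have g0 : geo_bounded w0.
  exists 4, (r + d); split=> // k l.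
  by rewrite nrm_real ger0_norm// mulr_ge0// exprn_ge0.
have [y [Y [yY hy]]] := subexp_dsummable ha g0.
have Y0 : 0 <= Y by apply: le_trans (dsummable_le 0%N yY); rewrite /psum big_ord0.
apply: (@differentiable_of_remainder f z p q d Y d0 Y0) => w t t0 t1 wt1 wt2.
have bzw : bidisc (z + w).
  have td : t * d <= d by rewrite ler_piMl// ltW.
  apply/bidiscP; split.
    by apply: le_lt_trans (ler_nrmD _ _) _; apply: le_lt_trans s1; rewrite lerD// (le_trans wt1).
  by apply: le_lt_trans (ler_nrmD _ _) _; apply: le_lt_trans s1; rewrite lerD// (le_trans wt2).
pose E k l := monom (z + w) k l - monom z k l - (w1 k l * w.1 + w2 k l * w.2).
have lim : wsum a E @ \oo --> f (z + w) - f z - (p * w.1 + q * w.2).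
  rewrite (_ : wsum a E = fun N => wsum a (monom (z + w)) N - wsum a (monom z) N -
      (wsum a w1 N * w.1 + wsum a w2 N * w.2)).
    apply: cvgB; first by apply: cvgB; [exact: fa|exact: fa].
    by apply: cvgD; apply: cvgM; try exact: cvg_cst; [exact: ap|exact: aq].
  apply/funext => N; rewrite /wsum /psum !mulr_suml -!sumrB -big_split /= -sumrB.
  apply: eq_bigr => k _; rewrite !mulr_suml -!sumrB -big_split /= -sumrB.
  by apply: eq_bigr => l _; rewrite /E; ring.
apply: nrm_lim_le lim => N.
have hE k l : nrm (a k l * E k l) <= t ^+ 2 * y k l.
  have := hy k l; rewrite !nrmM nrm_real ger0_norm; last by rewrite mulr_ge0// exprn_ge0.
  have hm := monom_remainder k l zr1 zr2 wt1 wt2 (ltW d0) t0 t1.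
  move=> h; apply: (le_trans (ler_wpM2l (nrm_ge0 _) hm)).
  by rewrite mulrCA ler_wpM2l// exprn_ge0.
have yY' := dsummableZ (exprn_ge0 2 t0) yY.
by apply: (le_trans (psum_ler N hE)); rewrite mulrC; exact: dsummable_le yY'.
Qed.

End Differentiability.

(** * The damping functions *)

Section Damping.
Variable R : realType.
Local Notation C := (Cplx R).
Implicit Types (f g : C * C -> C).

Lemma expands_bidisc f g a : expands f a -> (forall z, bidisc z -> g z = f z) ->
  expands g a.
Proof. by move=> [ha fa] gf; split=> [|z bz]; [exact: ha|rewrite (gf z bz); exact: fa]. Qed.

Lemma analytic_bidisc f g : analytic f -> (forall z, bidisc z -> g z = f z) ->
  analytic g.
Proof. by move=> [a fa] gf; exists a; exact: expands_bidisc fa gf. Qed.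

Lemma fun_calculus_bidisc m (M : mxpair R m) f g : analytic f ->
  (forall z, bidisc z -> g z = f z) -> fun_calculus g M = fun_calculus f M.
Proof.
move=> [a fa] gf; rewrite /fun_calculus (expands_coef fa).
by rewrite (expands_coef (expands_bidisc fa gf)).
Qed.

Definition damp (a : R) f z : C := a%:C%C / (1 + a%:C%C - f z).

Lemma nrm_sqr (x : C) : nrm x ^+ 2 = complex.Re x ^+ 2 + complex.Im x ^+ 2.
Proof. by case: x => u v; rewrite /nrm /= sqr_sqrtr// addr_ge0// sqr_ge0. Qed.

Lemma Re_le1 (x : C) : nrm x <= 1 -> complex.Re x <= 1.
Proof. by move=> x1; apply: le_trans (le_trans (ler_norm _) (ler_normRe x)) x1. Qed.

Lemma damp_den_neq0 (a : R) (x : C) : 0 < a -> nrm x <= 1 -> 1 + a%:C%C - x != 0.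
Proof.
move=> a0 /Re_le1 x1; apply: contraTneq (ltr01 : 0 < 1 :> R) => e.
have : complex.Re (1 + a%:C%C - x) = 0 by rewrite e.
by case: x x1 {e} => u v /= u1 e; rewrite ltNge; lra.
Qed.

(* With [u = 1 - x], [Re u >= 0], the two terms are [|a|^2 / |u + a|^2] and
   [|u|^2 / |u + a|^2], while [|u + a|^2 >= |u|^2 + a^2]. *)
Lemma damp_sqr_le (a : R) (x : C) : 0 < a -> nrm x <= 1 ->
  nrm (a%:C%C / (1 + a%:C%C - x)) ^+ 2 + nrm (1 - a%:C%C / (1 + a%:C%C - x)) ^+ 2 <= 1.
Proof.
move=> a0 x1; have d0 := damp_den_neq0 a0 x1.
have -> : 1 - a%:C%C / (1 + a%:C%C - x) = (1 - x) / (1 + a%:C%C - x).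
  by rewrite -{1}(divff d0) -mulrBl; congr (_ / _); ring.
have n0 : 0 < nrm (1 + a%:C%C - x) ^+ 2.
  rewrite exprn_gt0// lt_neqAle nrm_ge0 andbT eq_sym.
  by apply: contra d0 => /eqP/nrm0_eq0 ->.
rewrite !nrmM !nrmV !exprMn exprVn -mulrDl ler_pdivrMr// mul1r !nrm_sqr.
have := Re_le1 x1; case: x {x1 d0 n0} => u v /= u1; nra.
Qed.

(** With [b = 1 / (1 + a)] the function is the geometric series [a b sum_n (b f)^n]. Since
    [a b = 1 - b], its sums of moduli are at most 1. *)
Lemma damp_analytic (a : R) f : 0 < a -> analytic f ->
  (forall z, bidisc z -> nrm (f z) <= 1) -> analytic (damp a f).
Proof.
move=> a0 fa f1; pose b : R := (1 + a)^-1.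
have b0 : 0 < b by rewrite invr_gt0 addr_gt0.
have b1 : b < 1 by rewrite invf_lt1 ?addr_gt0// ltrDl.
have ab : a * b = 1 - b by rewrite /b; field; rewrite gt_eqF// addr_gt0.
pose g n z : C := (a * b)%:C%C * (b%:C%C ^+ n * f z ^+ n).
have ga n : analytic (g n).
  by apply: analyticM; [|apply: analyticM]; first [exact: analytic_cst|exact: analyticX].
have gsum z N : bidisc z -> \sum_(n < N) nrm (g n z) <= 1.
  move=> bz; apply: (@le_trans _ _ (\sum_(n < N) (1 - b) * b ^+ n)).
    apply: ler_sum => n _; rewrite !nrmM !nrmX !nrm_real ab ger0_norm ?subr_ge0 ?(ltW b1)//.
    rewrite (gtr0_norm b0) ler_wpM2l ?subr_ge0 ?(ltW b1)// ler_piMr ?exprn_ge0 ?(ltW b0)//.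
    by rewrite exprn_ile1 ?nrm_ge0// f1.
  rewrite -mulr_sumr -(opprB b 1) mulNr -subrX1 opprB gerBl.
  by rewrite exprn_ge0// ltW.
have [h [ha _ hlim _]] := analytic_series ga gsum.
apply: (analytic_bidisc ha) => z bz.
have d0 := damp_den_neq0 a0 (f1 z bz).
apply: cvgC_unique (hlim z bz).
have -> : damp a f z = damp a f z * (1 - 0) by rewrite subr0 mulr1.
pose q : C := b%:C%C * f z.
have q1 : nrm q < 1.
  rewrite nrmM nrm_real gtr0_norm//; apply: le_lt_trans b1.
  by rewrite ler_piMr ?(ltW b0)// f1.
have bE : b%:C%C * (1 + a%:C%C) = 1 :> C.
  by rewrite -[1 + _](rmorphD (real_complex R) 1 a) -rmorphM /= /b mulVf// gt_eqF// addr_gt0.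
have sE N : \sum_(n < N) g n z = damp a f z * (1 - q ^+ N).
  have -> : \sum_(n < N) g n z = (a * b)%:C%C * \sum_(n < N) q ^+ n.
    by rewrite mulr_sumr; apply: eq_bigr => n _; rewrite /q exprMn.
  have -> : 1 - q ^+ N = (1 - q) * \sum_(n < N) q ^+ n.
    by rewrite -[LHS]opprB subrX1 -mulNr opprB.
  have -> : 1 - q = b%:C%C * (1 + a%:C%C - f z) by rewrite mulrBr bE.
  apply: (mulIf d0); rewrite [RHS]mulrAC /damp divfK// rmorphM /=.
  by ring.
under eq_fun do rewrite sE.
apply: cvgM; first exact: cvg_cst.
apply: cvgB; first exact: cvg_cst.
apply: (@cvg_le_nrm _ _ _ (fun n => nrm q ^+ n)).
  by move=> n; rewrite subr0 nrmX.
have := @cvg_geometric R 1 (nrm q); rewrite ger0_norm ?nrm_ge0// => /(_ q1).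
rewrite (_ : geometric 1 (nrm q) = fun n => nrm q ^+ n) => [//|].
by apply/funext => n; rewrite /geometric /= mul1r.
Qed.

Section OnMatrix.
Variables (m : nat) (M : mxpair R m).
Hypothesis M_comm : comm_mx M.1 M.2.
Hypothesis M_spec : joint_spectrum M `<=` @bidisc R.

(** On the bidisc [damp a f] times [1 + a - f] is the constant [a]. Multiplicativity gives the same
    relation between the matrices, where the second factor is a nonzero scalar because
    [c < 1 + a]. *)
Lemma fun_calculus_damp (a c : R) f : 0 < a -> c < 1 + a -> analytic f ->
  (forall z, bidisc z -> nrm (f z) <= 1) -> fun_calculus f M = (c%:C%C : C)%:M ->
  fun_calculus (damp a f) M = ((a / (1 + a - c))%:C%C : C)%:M.
Proof.
move=> a0 ca fa f1 fc.
have ha := damp_analytic a0 fa f1.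
pose g z : C := (1 + a%:C%C) + (- 1) * f z.
have nfa : analytic (fun z => (- 1) * f z) := analyticM (analytic_cst _) fa.
have ga : analytic g by exact: analyticD (analytic_cst _) nfa.
have gM : fun_calculus g M = ((1 + a - c)%:C%C : C)%:M.
  rewrite (fun_calculusD M_comm M_spec (analytic_cst _) nfa).
  rewrite (fun_calculusM M_comm M_spec (analytic_cst _) fa) !fun_calculus_cst// fc.
  rewrite -[_%:M * _]scalar_mxM -raddfD /=; congr (_%:M).
  by rewrite rmorphB rmorphD /= mulN1r.
have : fun_calculus (fun z => damp a f z * g z) M = (a%:C%C : C)%:M.
  rewrite -(fun_calculus_cst M); apply: fun_calculus_bidisc.
    exact: analytic_cst.
  by move=> z bz; rewrite /damp /g mulN1r divfK// damp_den_neq0// f1.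
rewrite (fun_calculusM M_comm M_spec ha ga) gM => e.
have d0 : 1 + a - c != 0 by rewrite gt_eqF// subr_gt0.
have inv : ((1 + a - c)%:C%C : C)%:M * (((1 + a - c)^-1)%:C%C : C)%:M = 1 :> 'M[C]_m.+1.
  by rewrite -[LHS]scalar_mxM -rmorphM /= divff.
rewrite -[LHS]mulr1 -inv mulrA e.
by rewrite -[LHS]scalar_mxM -rmorphM.
Qed.

Lemma fun_calculus_prod (F : nat -> C * C -> C) (b : nat -> C) N :
  (forall j, analytic (F j)) ->
  (forall j, (j < N)%N -> fun_calculus (F j) M = (b j)%:M) ->
  fun_calculus (fun z => \prod_(0 <= j < N) F j z) M = (\prod_(0 <= j < N) b j)%:M.
Proof.
move=> Fa; elim: N => [|N IH] Fb.
  rewrite big_nil -(fun_calculus_cst M); apply: fun_calculus_bidisc.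
    exact: analytic_cst.
  by move=> z _; rewrite big_nil.
rewrite big_nat_recr //= scalar_mxM -IH => [|j jN]; last by rewrite Fb// (ltn_trans jN).
rewrite -Fb//.
have pa : analytic (fun z => \prod_(0 <= j < N) F j z) by exact: analytic_prod.
rewrite -[_ *m _]/(_ * _) -(fun_calculusM M_comm M_spec pa (Fa N)).
apply: fun_calculus_bidisc; first exact: analyticM pa (Fa N).
by move=> z _; rewrite big_nat_recr.
Qed.

(* The entries of [f^n(M)] are bounded by a constant times [B^n]. *)
Lemma fun_calculus1_ge1 f (B : R) : analytic f ->
  (forall z, bidisc z -> nrm (f z) <= B) -> fun_calculus f M = 1%:M -> 1 <= B.
Proof.
move=> fa fB f1; rewrite leNgt; apply/negP => B1.
have B0 : 0 <= B.
  apply: le_trans (nrm_ge0 _) (fB (0, 0) _).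
  by apply/bidiscP; rewrite /= nrm0.
have [K [r [K0 r0 r1 hw]]] := mxweight_geo M_comm M_spec ord0 ord0.
have yY := dsummableZ K0 (dsummable_geo r0 r1).
set y := (fun k l => _) in yY; set Y := (X in dsummable _ X) in yY.
have key n : 1 <= Y * B ^+ n.
  have [a ha] := analyticX n fa.
  have fnB z : bidisc z -> nrm (f z ^+ n) <= B ^+ n.
    by move=> bz; rewrite nrmX lerXn2r ?nnegrE ?nrm_ge0// fB.
  have aB := cauchy_estimate ha fnB.
  have ev := evals_fun_calculus M_comm M_spec ha.
  have := ev ord0 ord0; rewrite (fun_calculusX M_comm M_spec n fa) f1 expr1n !mxE /= => lim.
  rewrite -(nrm1 R); apply: nrm_lim_le lim => N.
  have := @psum_ler _ (fun k l => a k l * mxweight M k l ord0 ord0)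
    (fun k l => B ^+ n * y k l) N.
  move=> /(_ _)/le_trans; apply.
    by move=> k l; rewrite nrmM ler_pM ?nrm_ge0// /y.
  by rewrite mulrC; exact: dsummable_le (dsummableZ (exprn_ge0 n B0) yY).
have := @cvg_geometric R Y B; rewrite ger0_norm// => /(_ B1) lim.
suff : (1 : R) <= 0 by rewrite ler10.
rewrite -(cvg_lim (@Rhausdorff R) lim); apply: limr_ge.
  by apply/cvg_ex; exists 0.
by apply: nearW => n; exact: key.
Qed.

End OnMatrix.

End Damping.

(** * Interpolation from peak functions *)

Section Interpolation.
Variable R : realType.
Local Notation C := (Cplx R).

(** The product kept on the left is the mass not yet spent: passing from [N] to [N + 1] replaces it
    by at most [s N + t N] times itself. *)
Lemma sum_telescope_le (s t : nat -> R) N :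
  (forall n, 0 <= t n) -> (forall n, s n + t n <= 1) ->
  \sum_(n < N) s n * \prod_(0 <= j < n) t j + \prod_(0 <= j < N) t j <= 1.
Proof.
move=> t0 st; elim: N => [|N IH]; first by rewrite big_ord0 big_nil add0r.
apply: le_trans IH; rewrite big_ord_recr /= big_nat_recr //= -addrA lerD2l.
have P0 : 0 <= \prod_(0 <= j < N) t j by rewrite prodr_ge0.
by rewrite (mulrC _ (t N)) -mulrDl ler_piMl.
Qed.

Lemma nrm_prod (s : seq nat) (F : nat -> C) :
  nrm (\prod_(j <- s) F j) = \prod_(j <- s) nrm (F j).
Proof.
elim: s => [|j s IH]; first by rewrite !big_nil nrm1.
by rewrite !big_cons nrmM IH.
Qed.

Lemma scalar_mx_mulr m (a b : C) : a%:M * b%:M = (a * b)%:M :> 'M[C]_m.+1.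
Proof. by rewrite scalar_mxM. Qed.

Definition peak (f : nat -> C * C -> C) (c : nat -> R) n z : C :=
  f n z * damp (1 - c n) (f n) z ^+ 2 *
  \prod_(0 <= j < n) (1 - damp (1 - c j) (f j) z) ^+ 2.

(** The factor 1/2 is [(1 - c) / (1 + (1 - c) - c)], the value of the damping function at [A n].
    Each [1 / (2 - c j)] is the value of its complement where [f j] vanishes. *)
Definition peak_value (c : nat -> R) n : R :=
  c n * 2^-1 ^+ 2 * \prod_(0 <= j < n) (2 - c j)^-1 ^+ 2.

Section Peaks.
Variables (m : nat -> nat) (A : forall n, mxpair R (m n)).
Hypothesis A_comm : forall n, comm_mx (A n).1 (A n).2.
Hypothesis A_spec : forall n, joint_spectrum (A n) `<=` @bidisc R.
Variables (f : nat -> C * C -> C) (c : nat -> R).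
Hypothesis c0 : forall n, 0 < c n.
Hypothesis c1 : forall n, c n < 1.
Hypothesis f_analytic : forall n, analytic (f n).
Hypothesis f_le1 : forall n z, bidisc z -> nrm (f n z) <= 1.
Hypothesis f_diag : forall n, fun_calculus (f n) (A n) = ((c n)%:C%C : C)%:M.
Hypothesis f_off : forall n k, k != n -> fun_calculus (f n) (A k) = 0.

Let a_gt0 n : 0 < 1 - c n. Proof. by rewrite subr_gt0. Qed.

Lemma damp_peak_analytic n : analytic (damp (1 - c n) (f n)).
Proof. by apply: damp_analytic => // z; exact: f_le1. Qed.

Lemma undamp_analytic n : analytic (fun z => (1 - damp (1 - c n) (f n) z) ^+ 2).
Proof.
apply: analyticX; have := analyticD (analytic_cst 1)
  (analyticM (analytic_cst (-1)) (damp_peak_analytic n)).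
by move=> /analytic_bidisc; apply=> z _; rewrite mulN1r.
Qed.

Lemma peak_analytic n : analytic (peak f c n).
Proof.
have h2 := analyticX 2 (damp_peak_analytic n).
exact: analyticM (analyticM (f_analytic n) h2) (analytic_prod _ undamp_analytic).
Qed.

Lemma sum_peak_le z N : bidisc z -> \sum_(n < N) nrm (peak f c n z) <= 1.
Proof.
move=> bz; pose h n := damp (1 - c n) (f n) z.
have := @sum_telescope_le (fun n => nrm (h n) ^+ 2) (fun n => nrm (1 - h n) ^+ 2) N.
move=> tel; apply: le_trans (tel _ _); last first.
- by move=> n; exact: damp_sqr_le (a_gt0 n) (f_le1 n bz).
- by move=> n; rewrite exprn_ge0// nrm_ge0.
rewrite (@le_trans _ _ (\sum_(n < N) nrm (h n) ^+ 2 * \prod_(0 <= j < n) nrm (1 - h j) ^+ 2))//.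
  apply: ler_sum => n _; rewrite /peak nrmM (nrmM (f n z)) nrmX nrm_prod.
  rewrite (eq_bigr (fun j => nrm (1 - h j) ^+ 2)) => [|j _]; last by rewrite nrmX.
  rewrite ler_wpM2r ?ler_piMl ?f_le1 ?exprn_ge0 ?nrm_ge0//.
  by apply: prodr_ge0 => j _; rewrite exprn_ge0// nrm_ge0.
by rewrite lerDl prodr_ge0// => j _; rewrite exprn_ge0// nrm_ge0.
Qed.

Lemma fun_calculus_peak_off n k : k != n -> fun_calculus (peak f c n) (A k) = 0.
Proof.
move=> kn; have Ac := A_comm k; have As := @A_spec k.
have h2 := analyticX 2 (damp_peak_analytic n).
rewrite (fun_calculusM Ac As (analyticM (f_analytic n) h2) (analytic_prod _ undamp_analytic)).
by rewrite (fun_calculusM Ac As (f_analytic n) h2) f_off// !mul0r.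
Qed.

Lemma fun_calculus_undamp n k : k != n ->
  fun_calculus (fun z => (1 - damp (1 - c n) (f n) z) ^+ 2) (A k) =
  (((2 - c n)^-1 ^+ 2)%:C%C : C)%:M.
Proof.
move=> kn; have Ac := A_comm k; have As := @A_spec k.
have dM : fun_calculus (damp (1 - c n) (f n)) (A k) =
    (((1 - c n) / (1 + (1 - c n) - 0))%:C%C : C)%:M.
  apply: (fun_calculus_damp Ac As (a_gt0 n) _ (f_analytic n) (@f_le1 n)).
    by rewrite addr_gt0.
  by rewrite f_off//; apply/matrixP => i j; rewrite !mxE mul0rn.
have na := analyticM (analytic_cst (-1)) (damp_peak_analytic n).
have ua := analyticD (analytic_cst 1) na.
rewrite (@fun_calculus_bidisc _ _ _ _ _ (analyticX 2 ua)); last first.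
  by move=> z _; rewrite mulN1r.
rewrite (fun_calculusX Ac As 2 ua) (fun_calculusD Ac As (analytic_cst 1) na).
rewrite (fun_calculusM Ac As (analytic_cst _) (damp_peak_analytic n)) !fun_calculus_cst dM.
rewrite -[_%:M * _]scalar_mxM -raddfD /= expr2 -[LHS]scalar_mxM; congr (_%:M).
rewrite mulN1r -(rmorph1 (real_complex R)) -rmorphB -rmorphM /=; congr (_%:C%C).
have d2 : 2 - c n != 0 by rewrite gt_eqF// subr_gt0 (lt_trans (c1 n))// ltr1n.
by field.
Qed.

Lemma fun_calculus_peak_diag n :
  fun_calculus (peak f c n) (A n) = ((peak_value c n)%:C%C : C)%:M.
Proof.
have Ac := A_comm n; have As := @A_spec n.
have h2 := analyticX 2 (damp_peak_analytic n).
have hM : fun_calculus (damp (1 - c n) (f n)) (A n) = ((2^-1 : R)%:C%C : C)%:M.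
  rewrite (fun_calculus_damp Ac As (a_gt0 n) _ (f_analytic n) (@f_le1 n) (f_diag n)).
    congr ((_)%:C%C)%:M; have := a_gt0 n => a0.
    by field; rewrite gt_eqF//; lra.
  by have := c1 n; lra.
rewrite (fun_calculusM Ac As (analyticM (f_analytic n) h2) (analytic_prod _ undamp_analytic)).
rewrite (fun_calculusM Ac As (f_analytic n) h2) f_diag.
rewrite (fun_calculusX Ac As 2 (damp_peak_analytic n)) hM.
rewrite (@fun_calculus_prod _ _ _ Ac As _ (fun j => ((2 - c j)^-1 ^+ 2)%:C%C) n undamp_analytic).
  rewrite expr2 !scalar_mx_mulr; congr (_%:M).
  by rewrite /peak_value !rmorphM /= rmorph_prod.
by move=> j jn; apply: fun_calculus_undamp; rewrite gt_eqF.
Qed.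

(** [c <= 1 / (2 - c)] amounts to [(1 - c)^2 >= 0]. The factor [c n] is bounded below by its square,
    so that the squared product up to [n] included can be compared with [p^2]; the remaining 1/4
    gives [(p / 2)^2]. *)
Lemma peak_value_ge (p : R) : 0 <= p -> (forall N, p <= \prod_(0 <= j < N) c j) ->
  forall n, (p / 2) ^+ 2 <= peak_value c n.
Proof.
move=> p0 pc n.
have h1 : p ^+ 2 <= (\prod_(0 <= j < n.+1) c j) ^+ 2 by rewrite lerXn2r// nnegrE// (le_trans p0).
have h2 : (\prod_(0 <= j < n.+1) c j) ^+ 2 <= c n * \prod_(0 <= j < n) (2 - c j)^-1 ^+ 2.
  have hp : 0 <= \prod_(0 <= j < n) c j by apply: prodr_ge0 => j _; exact: ltW.
  rewrite big_nat_recr //= exprMn mulrC; apply: ler_pM.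
  - by rewrite exprn_ge0// ltW.
  - by rewrite exprn_ge0.
  - by rewrite expr2 ler_piMl// ltW.
  rewrite -prodrXl; apply: ler_prod => j _.
  have cj0 := c0 j; have cj1 := c1 j.
  rewrite exprn_ge0 ?(ltW cj0)//= lerXn2r ?nnegrE ?invr_ge0 ?subr_ge0 ?(ltW cj0)//; first lra.
  rewrite -[leLHS]invrK lef_pV2 ?posrE ?invr_gt0//; last by lra.
  rewrite -[leRHS]mul1r ler_pdivlMr//; nra.
rewrite /peak_value mulrAC exprMn.
by rewrite ler_wpM2r ?exprn_ge0 ?invr_ge0// (le_trans h1).
Qed.

Lemma interpolation_of_peaks (p B : R) (phi : nat -> C * C -> C) :
  0 < p -> (forall N, p <= \prod_(0 <= j < N) c j) ->
  (forall n, analytic (phi n)) -> (forall n z, bidisc z -> nrm (phi n z) <= B) ->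
  exists psi, [/\ analytic psi, exists D, forall z, bidisc z -> nrm (psi z) <= D &
    forall n, fun_calculus psi (A n) = fun_calculus (phi n) (A n)].
Proof.
move=> p0 pc phia phiB.
have bz0 : bidisc ((0, 0) : C * C) by apply/bidiscP; rewrite /= nrm0.
have B0 : 0 <= B by exact: le_trans (nrm_ge0 _) (phiB 0%N _ bz0).
pose b := (p / 2) ^+ 2.
have b0 : 0 < b by rewrite exprn_gt0// divr_gt0.
have bv n : b <= peak_value c n by exact: peak_value_ge (ltW p0) pc n.
have v0 n : 0 < peak_value c n by exact: lt_le_trans (bv n).
pose g n z : C := ((peak_value c n)^-1)%:C%C * (phi n z * peak f c n z).
have pp n := analyticM (phia n) (peak_analytic n).
have ga n : analytic (g n) by exact: analyticM (analytic_cst _) (pp n).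
have gsum z N : bidisc z -> \sum_(n < N) nrm (g n z) <= b^-1 * B.
  move=> bz; apply: (@le_trans _ _ (\sum_(n < N) b^-1 * B * nrm (peak f c n z))).
    apply: ler_sum => n _; rewrite nrmM (nrmM (phi n z)) nrm_real mulrA.
    rewrite ler_wpM2r ?nrm_ge0// gtr0_norm ?invr_gt0// ler_pM ?invr_ge0 ?(ltW (v0 n)) ?nrm_ge0 ?phiB//.
    by rewrite lef_pV2 ?posrE.
  rewrite -mulr_sumr ler_piMr ?sum_peak_le//.
  by rewrite mulr_ge0// invr_ge0 ltW.
have [psi [psia psiB _ psiM]] := analytic_series ga gsum.
exists psi; split; [exact: psia|by exists (b^-1 * B)|move=> k].
have Ac := A_comm k; have As := @A_spec k.
(* Only the term [n = k] survives at [A k]. There the peak is a scalar matrix, cancelled exactly by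
   the normalising constant. *)
have gM n : fun_calculus (g n) (A k) = if n == k then fun_calculus (phi k) (A k) else 0.
  rewrite (fun_calculusM Ac As (analytic_cst _) (pp n)).
  rewrite (fun_calculusM Ac As (phia n) (peak_analytic n)) fun_calculus_cst.
  case: eqVneq => [->|nk]; last by rewrite fun_calculus_peak_off 1?eq_sym// !mulr0.
  rewrite fun_calculus_peak_diag -[LHS]/(_ *m (_ *m _)) mul_mx_scalar mul_scalar_mx.
  have inv : ((peak_value c k)^-1)%:C%C * (peak_value c k)%:C%C = 1 :> C.
    by rewrite -(rmorphM (real_complex R)) mulVf// gt_eqF.
  rewrite scalerA (_ : _ * _ = 1); first exact: scale1r.
  exact: inv.
apply/matrixP => i j.
apply: cvgC_unique (psiM _ _ Ac As i j) _.
apply: cvg_near_cst; exists k.+1 => // N /= kN.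
rewrite (bigD1 (Ordinal kN))//= gM eqxx big1 ?addr0// => n nk.
rewrite gM ifF ?mxE//; apply/negbTE; apply: contra nk => /eqP nk.
by apply/eqP/val_inj.
Qed.

End Peaks.

Lemma nrm_le_supnorm (f : C * C -> C) z : Hinf f -> bidisc z -> nrm (f z) <= supnorm f.
Proof. by move=> [_ ub] bz; apply: ub_le_sup => //; exists z. Qed.

Lemma Hinf_analytic (f : C * C -> C) (B : R) : analytic f ->
  (forall z, bidisc z -> nrm (f z) <= B) -> Hinf f.
Proof.
move=> [a fa] fB; split; first exact: expands_holomorphic fa.
by exists B => _ [z bz <-]; exact: fB.
Qed.

End Interpolation.

(** * Gleason separation *)

Section Rho.
Variable R : realType.
Local Notation C := (Cplx R).
Variables (m : nat -> nat) (A : forall n, mxpair R (m n)).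
Hypothesis A_comm : forall n, comm_mx (A n).1 (A n).2.
Hypothesis A_spec : forall n, joint_spectrum (A n) `<=` @bidisc R.

(** Without an expansion the calculus returns 0, which is not the identity since the size is
    positive. *)
Lemma fun_calculus1_analytic n (f : C * C -> C) :
  fun_calculus f (A n) = 1%:M -> analytic f.
Proof.
move=> f1; apply: contrapT => nf; move: f1; rewrite fun_calculus_no_expansion//.
by move/eqP; rewrite eq_sym oner_eq0.
Qed.

Lemma rhoG_norms_ge1 n tau (x : R) : rhoG_norms A n tau x -> 1 <= x.
Proof.
move=> [f [fH f1 _] <-].
have fB z (bz : bidisc z) := nrm_le_supnorm fH bz.
exact: fun_calculus1_ge1 (A_comm n) (@A_spec n) _ _ (fun_calculus1_analytic f1) fB f1.
Qed.

Lemma rhoG_ge0 n tau : 0 <= rhoG A n tau.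
Proof.
rewrite /rhoG; case: eqP => // /eqP/set0P ne.
by rewrite invr_ge0 (le_trans ler01)// lb_le_inf// => x; exact: rhoG_norms_ge1.
Qed.

Lemma rhoG_le1 n tau : rhoG A n tau <= 1.
Proof.
rewrite /rhoG; case: eqP => [_|/eqP/set0P ne]; first exact: ler01.
have h : 1 <= inf (rhoG_norms A n tau) by apply: lb_le_inf => // x; exact: rhoG_norms_ge1.
by rewrite invf_le1// (lt_le_trans ltr01).
Qed.

(** As [c^-1] exceeds the infimum, some competitor has norm below [c^-1]; multiplied by [c] it
    enters the unit ball. *)
Lemma rhoG_peak n tau (c : R) : 0 < c -> c < rhoG A n tau ->
  exists f : C * C -> C, [/\ analytic f, forall z, bidisc z -> nrm (f z) <= 1,
    fun_calculus f (A n) = ((c%:C)%C : C)%:M &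
    forall k, tau k -> fun_calculus f (A k) = 0].
Proof.
move=> c0; rewrite /rhoG; case: eqP => [_ /lt_trans/(_ c0)|/eqP/set0P ne cr].
  by rewrite ltxx.
have h : 1 <= inf (rhoG_norms A n tau) by apply: lb_le_inf => // x; exact: rhoG_norms_ge1.
have : inf (rhoG_norms A n tau) < c^-1.
  by rewrite -[ltLHS]invrK ltf_pV2 ?posrE// invr_gt0 (lt_le_trans ltr01).
move=> /(inf_lt ne)[_ [f [fH f1 f0] <-]] fc.
have fa := fun_calculus1_analytic f1.
have ca := analytic_cst (c%:C%C : C).
exists (fun z => c%:C%C * f z); split.
- exact: analyticM ca fa.
- move=> z bz; rewrite nrmM nrm_real gtr0_norm//.
  rewrite mulrC -ler_pdivlMr// mul1r.
  exact: le_trans (nrm_le_supnorm fH bz) (ltW fc).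
- rewrite (fun_calculusM (A_comm n) (@A_spec n) ca fa) fun_calculus_cst f1.
  by rewrite mulr1.
- move=> k tk.
  by rewrite (fun_calculusM (A_comm k) (@A_spec k) ca fa) f0// mulr0.
Qed.

(* [q n = u (n+1) / u n] with [u n = (n+2)/(n+1)] decreasing from 2 to 1. *)
Lemma strict_lower_factors : exists q : nat -> R,
  [/\ forall n, 0 < q n, forall n, q n < 1 & forall N, 2^-1 <= \prod_(0 <= j < N) q j].
Proof.
pose u n : R := n.+2%:R / n.+1%:R.
have u0 n : 0 < u n by rewrite divr_gt0// ltr0n.
have u1 n : 1 < u n by rewrite ltr_pdivlMr ?ltr0n// mul1r ltr_nat.
exists (fun n => u n.+1 / u n); split=> [n|n|N].
- by rewrite divr_gt0.
- rewrite ltr_pdivrMr// mul1r /u ltr_pdivrMr ?ltr0n// mulrAC ltr_pdivlMr ?ltr0n//.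
  by rewrite -!natrM ltr_nat; lia.
have -> : \prod_(0 <= j < N) (u j.+1 / u j) = u N / u 0%N.
  elim: N => [|N IH]; first by rewrite big_nil divff// gt_eqF.
  by rewrite big_nat_recr //= IH mulrC mulrA divfK ?gt_eqF.
rewrite /u [2%:R / 1%:R]divr1 ler_pdivlMr// mulVf// ltW//; exact: u1.
Qed.

End Rho.

Theorem theorem1p13 (R : realType) (m : nat -> nat)
    (A : forall n, mxpair R (m n))
    (A_comm : forall n, comm_mx (A n).1 (A n).2)
    (A_spec : forall n, joint_spectrum (A n) `<=` @bidisc R)
    (* each factor lies in [0, 1], so the partial products converge *)
    (prod_pos : 0 < limn (fun N : nat => \prod_(n < N) rhoG A n (~` [set (n : nat)]))) :
  interpolating A.
Proof.
set rho := fun n : nat => rhoG A n (~` [set n]).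
set P := (fun N : nat => _) in prod_pos; set p := limn P in prod_pos.
have rho0 n : 0 <= rho n by exact: rhoG_ge0.
have rho1 n : rho n <= 1 by exact: rhoG_le1.
have P0 N : 0 <= P N by apply: prodr_ge0 => n _; exact: rho0.
have Pd : nonincreasing_seq P.
  by apply/nonincreasing_seqP => N; rewrite /P big_ord_recr /=; apply: ler_piMr; [exact: P0|exact: rho1].
have Pc : cvgn P by apply: nonincreasing_is_cvgn => //; exists 0 => _ [N _ <-].
have pP N : p <= P N by exact: nonincreasing_cvgn_ge.
(* A zero factor would annihilate the partial product [P n.+1], which is bounded below by the
   positive limit. *)
have rho_gt0 n : 0 < rho n.
  rewrite lt_neqAle rho0 andbT; apply: contraTneq (lt_le_trans prod_pos (pP n.+1)) => r0.
  by rewrite /P big_ord_recr /= -/(rho n) -r0 mulr0 ltxx.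
(* The factors [q n] make [c n] strictly less than [rho n], and so less than 1 even when
   [rho n = 1], while halving the product at worst. *)
have [q [q0 q1 qP]] := strict_lower_factors R.
pose c n := rho n * q n.
have c0 n : 0 < c n by rewrite mulr_gt0.
have crho n : c n < rho n by rewrite /c gtr_pMr.
have c1 n : c n < 1 by exact: lt_le_trans (rho1 n).
have pc N : p / 2 <= \prod_(0 <= j < N) c j.
  by rewrite big_split /= ler_pM ?(ltW prod_pos)// big_mkord; exact: pP.
have /choice[f hf] n := rhoG_peak A_comm A_spec (c0 n) (crho n).
move=> phi phiH [B phiB].
(* A datum without expansion has calculus 0, so replacing it by the zero function leaves the
   interpolation problem unchanged. *)
pose phi' n := if pselect (analytic (phi n)) then phi n else fun=> 0.
have bz0 : bidisc ((0, 0) : Cplx R * Cplx R) by apply/bidiscP; rewrite /= nrm0.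
have phi'a n : analytic (phi' n).
  by rewrite /phi'; case: pselect => h //=; exact: analytic_cst.
have phi'B n z : bidisc z -> nrm (phi' n z) <= B.
  move=> bz; rewrite /phi'; case: pselect => h /=.
    exact: le_trans (nrm_le_supnorm (phiH n) bz) (phiB n).
  rewrite nrm0; apply: le_trans (le_trans (nrm_le_supnorm (phiH 0%N) bz0) (phiB 0%N)).
  exact: nrm_ge0.
have phi'E n : fun_calculus (phi' n) (A n) = fun_calculus (phi n) (A n).
  rewrite /phi'; case: pselect => [h|nphi]; first exact: erefl.
  rewrite (fun_calculus_cst (A n) 0) (fun_calculus_no_expansion (A n) nphi).
  exact: raddf0.
have [|||||psi [psia [D psiD] psiM]] := @interpolation_of_peaks R m A A_comm A_spec f c
  c0 c1 _ _ _ _ (p / 2) B phi' _ pc phi'a phi'B.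
- by move=> n; have [] := hf n.
- by move=> n; have [] := hf n.
- by move=> n; have [] := hf n.
- by move=> n k kn; have [_ _ _] := hf n; apply; apply/eqP.
- by rewrite divr_gt0.
exists psi; split; first exact: Hinf_analytic psia psiD.
move=> n; rewrite (psiM n); exact (phi'E n).
Qed.
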